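(* Let $S$ and $R$ be finite-dimensional real Hilbert spaces, with coordinate isomorphism $D_S : S \to \mathbb{R}^{N_S}$, $N_S=\dim S$, with respect to a fixed basis of $S$, and let $\underline{M}_S$ be the inner product (Gram) matrix of $S$ in that basis, with largest and smallest eigenvalues $\lambda^{\underline{M}_S}_{\max}$ and $\lambda^{\underline{M}_S}_{\min}$. Let $O : S \to R$ be a nonzero linear operator of rank $N_O$, $n_t \ge 1$ an integer, and $\varepsilon_{\mathrm{testfail}} \in (0,1)$. Let $\underline{r}_1,\dots,\underline{r}_{n_t}$ be independent random normal vectors in $\mathbb{R}^{N_S}$ and define $$ \Delta(O,n_t,\varepsilon_{\mathrm{testfail}}) := c_{\mathrm{est}}(n_t,\varepsilon_{\mathrm{testfail}}) \max_{i=1,\dots,n_t} \|O D_S^{-1}\underline{r}_i\|_R, \qquad c_{\mathrm{est}}(n_t,\varepsilon_{\mathrm{testfail}}) := \frac{1}{\sqrt{2\lambda^{\underline{M}_S}_{\min}}\;\operatorname{erf}^{-1}\!\left(\sqrt[n_t]{\varepsilon_{\mathrm{testfail}}}\right)}, $$ and the effectivity $$ \eta(O,n_t,\varepsilon_{\mathrm{testfail}}) := \frac{\Delta(O,n_t,\varepsilon_{\mathrm{testfail}})}{\|O\|}. $$ Then $$ P\big(\eta(O,n_t,\varepsilon_{\mathrm{testfail}}) \le c_{\mathrm{eff}}(n_t,\varepsilon_{\mathrm{testfail}})\big) \ge 1-\varepsilon_{\mathrm{testfail}}, $$ where $$ c_{\mathrm{eff}}(n_t,\varepsilon_{\mathrm{testfail}})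 := \left[ Q^{-1}\!\left(\frac{N_O}{2},\frac{\varepsilon_{\mathrm{testfail}}}{n_t}\right) \frac{\lambda^{\underline{M}_S}_{\max}}{\lambda^{\underline{M}_S}_{\min}} \left(\operatorname{erf}^{-1}\!\left(\sqrt[n_t]{\varepsilon_{\mathrm{testfail}}}\right)\right)^{-2}\right]^{1/2}. $$
   Context: A random normal vector in $\mathbb{R}^{N_S}$ is a vector whose entries are independent standard normal (mean $0$, variance $1$) random variables. The coordinate isomorphism $D_S$ maps an element of $S$ to the vector of its coefficients in the fixed basis, so that $(v,w)_S = (D_S v)^T\underline{M}_S(D_S w)$ for all $v,w\in S$. The operator norm is $\|O\| := \sup_{0\neq\xi\in S}\|O\xi\|_R/\|\xi\|_S$. Here $\operatorname{erf}(x)=\frac{2}{\sqrt{\pi}}\int_0^x e^{-t^2}\,dt$ is the error function and $\operatorname{erf}^{-1}$ its inverse. $Q$ is the upper normalized incomplete gamma function $Q(a,x)=\dfrac{\int_x^\infty t^{a-1}e^{-t}\,dt}{\int_0^\infty t^{a-1}e^{-t}\,dt}$, and $Q^{-1}$ is its inverse in the second argument: $Q^{-1}(a,y)=x$ when $Q(a,x)=y$. *)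

(* Defs.v *)
From HB Require Import structures.
From mathcomp Require Import all_boot all_order all_algebra.
From mathcomp Require Import all_classical all_reals all_analysis.

Set Implicit Arguments.
Unset Strict Implicit.
Unset Printing Implicit Defensive.

Import Order.TTheory GRing.Theory Num.Theory.
Import numFieldNormedType.Exports.

Local Open Scope classical_set_scope.
Local Open Scope ring_scope.

(* A finite-dimensional real Hilbert space is a vectType over a realType
   with a symmetric positive definite bilinear form {dot V for idfun};
   completeness is automatic in finite dimension. *)
Section hilbert.
Context {K : realType}.

Definition hnorm (V : vectType K) (ip : {dot V for idfun}) (v : V) : K :=
  Num.sqrt (ip v v).

Definition opnorm (S R : vectType K) (ipS : {dot S for idfun})
    (ipR : {dot R for idfun}) (O : 'Hom(S, R)) : K :=
  sup [set hnorm ipR (O xi) / hnorm ipS xi | xi in [set xi : S | xi != 0]].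

Definition gram (V : vectType K) (ip : {dot V for idfun})
    (B : (\dim {:V}).-tuple V) : 'M[K]_(\dim {:V}) :=
  \matrix_(i, j) ip B`_i B`_j.

(* Coordinate vectors are rows, so (D v)^T M (D w) reads as below. *)
Lemma gramE (V : vectType K) (ip : {dot V for idfun})
    (B : (\dim {:V}).-tuple V) (v w : V) : basis_of fullv B ->
  ip v w = (passmx.rVof B v *m gram ip B *m (passmx.rVof B w)^T) 0 0.
Proof.
move=> Bb.
rewrite {1}(coord_basis Bb (memvf v)) {1}(coord_basis Bb (memvf w)).
rewrite linear_sumr mxE; apply: eq_bigr => j _.
rewrite linear_sumlz /= !mxE mulr_suml; apply: eq_bigr => i _.
by rewrite linearZl_LR linearZr_LR /= !mxE mulrA mulrAC.
Qed.

Definition lambda_max n (M : 'M[K]_n) : K := sup [set a | eigenvalue M a].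
Definition lambda_min n (M : 'M[K]_n) : K := inf [set a | eigenvalue M a].

End hilbert.

Section special_functions.
Context {K : realType}.
Local Notation mu := (@lebesgue_measure K).

(* The difference of the two integrals is the oriented integral from 0 to x:
   the first vanishes for x <= 0 and the second for x >= 0. *)
Definition erf (x : K) : K :=
  2 / Num.sqrt pi *
  (\int[mu]_(t in `[0, x]) expR (- t ^+ 2) -
   \int[mu]_(t in `[x, 0]) expR (- t ^+ 2)).

Definition erfinv (y : K) : K := xget 0 [set x | erf x = y].

Definition Qgamma (a x : K) : K :=
  (\int[mu]_(t in `[x, +oo[) (t `^ (a - 1) * expR (- t))) /
  (\int[mu]_(t in `[0%R, +oo[) (t `^ (a - 1) * expR (- t))).

(* Q a is a function on [0, +oo[: below 0 the integrand is a junk value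
   of powR. *)
Definition Qgamma_inv (a y : K) : K := xget 0 [set x | 0 <= x /\ Qgamma a x = y].

End special_functions.

Section random_vectors.
Context {d : measure_display} {T : measurableType d} {K : realType}.
Variable P : probability T K.

Definition mutually_independent (I : finType) {d' : measure_display}
    {U : measurableType d'} (X : I -> {RV P >-> U}) : Prop :=
  forall (J : {set I}) (A : I -> set U),
    (forall i, i \in J -> measurable (A i)) ->
    P [set w | forall i, i \in J -> A i (X i w)] =
    (\prod_(i in J) P (X i @^-1` A i))%E.

(* R^N carries the library's product sigma-algebra on tuples, since the
   library has no measurable structure on 'rV[K]_N. *)
Definition entry N (X : {RV P >-> N.-tuple K}) (j : 'I_N) : T -> K :=
  fun w => tnth (X w) j.

Lemma measurable_entry N (X : {RV P >-> N.-tuple K}) (j : 'I_N) :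
  measurable_fun setT (entry X j).
Proof. exact: measurableT_comp (measurable_tnth j) (measurable_funPT X). Qed.

HB.instance Definition _ N (X : {RV P >-> N.-tuple K}) (j : 'I_N) :=
  isMeasurableFun.Build _ _ _ _ (entry X j) (measurable_entry X j).

Definition random_normal_vector N (X : {RV P >-> N.-tuple K}) : Prop :=
  mutually_independent (fun j => entry X j : {RV P >-> K}) /\
  forall (j : 'I_N) (A : set K), measurable A ->
    distribution P (entry X j) A = normal_prob 0 1 A.

End random_vectors.

Section estimator.
Context {K : realType} {S R : vectType K}.
Variables (ipS : {dot S for idfun}) (ipR : {dot R for idfun}).
Variable B : (\dim {:S}).-tuple S.
Variable O : 'Hom(S, R).

Definition Dinv (x : (\dim {:S}).-tuple K) : S :=
  passmx.vecof B (\row_j tnth x j).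

Definition c_est (nt : nat) (eps : K) : K :=
  (Num.sqrt (2 * lambda_min (gram ipS B)) * erfinv (eps `^ (nt%:R^-1)))^-1.

Definition c_eff (nt : nat) (eps : K) : K :=
  Num.sqrt (Qgamma_inv ((\dim (limg O))%:R / 2) (eps / nt%:R) *
            (lambda_max (gram ipS B) / lambda_min (gram ipS B)) *
            erfinv (eps `^ (nt%:R^-1)) ^- 2).

(* The norms are nonnegative, so starting the maximum at 0 is harmless
   when 0 < nt. *)
Definition Delta (nt : nat) (eps : K)
    (r : 'I_nt -> (\dim {:S}).-tuple K) : K :=
  c_est nt eps * \big[Num.max/0]_(i < nt) hnorm ipR (O (Dinv (r i))).

Definition effectivity (nt : nat) (eps : K)
    (r : 'I_nt -> (\dim {:S}).-tuple K) : K :=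
  Delta eps r / opnorm ipS ipR O.

End estimator.

(* Main.v *)
Require Import Defs.
From HB Require Import structures.
From mathcomp Require Import all_boot all_order all_algebra.
From mathcomp Require Import all_classical all_reals all_analysis measurable_realfun.
From mathcomp Require Import ring lra.

Import Order.TTheory GRing.Theory Num.Theory.
Import numFieldNormedType.Exports.
Local Open Scope classical_set_scope.
Local Open Scope ring_scope.

Set Implicit Arguments.
Unset Strict Implicit.
Unset Printing Implicit Defensive.

(** Write r for one of the vectors r_i. The squared norm of O (D^-1 r) depends
    on r only through a linear map of rank k = dim (limg O), that is, through k
    coordinates of r in a suitable orthonormal frame of R^N. If y denotes r in
    that frame and J the set of those k coordinates, then dropping the others
    does not change the image, so
      |O (D^-1 r)|^2 <= |O|^2 * lambda_max * (\sum_(j in J) y_j^2),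
    by the Rayleigh bound for the Gram matrix (hnorm_image_vecof_le). A rotation
    of a standard normal vector is again standard normal, so half of the sum on
    the right has the Gamma(k/2) law, whose tail function is Q(k/2, .)
    (half_sqnorm_on_tail). At q = Q^-1(k/2, eps/nt) each of the nt vectors
    exceeds q with probability eps/nt, and a union bound leaves probability at
    least 1 - eps for the event that none does. On that event the effectivity
    is at most c_eff (effectivity_le): the erf^-1 factor cancels up to its sign
    and sqrt (2 * lambda_min) turns into the quotient of eigenvalues.

    Three ingredients carry the argument.

    Rotation invariance. A rotation in one coordinate plane is a composition of
    affine substitutions in one variable, so it preserves the product of two
    standard normal laws by Tonelli (normal_prob_rotation); uniqueness of
    product measures transfers this to a family of independent normal variables
    (iid_plane_rotation). Rotations in coordinate planes suffice to concentrate
    the dependence on k coordinates: as long as more than k rows of an n x k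
    matrix survive, they are linearly dependent, and rotating the vector of a
    dependency onto a coordinate axis kills one more row
    (gaussian_row_compression).

    Gamma laws. The square of a normal variable, halved, has density
    proportional to t^(-1/2) e^(-t) (gamma_law_half_sqr), and the convolution of
    two gamma densities is proportional to a gamma density (gamma_lawD). The
    constants of proportionality are recovered from the total mass 1. Existence
    of the quantile q is the intermediate value theorem (Qgamma_invK).

    Rayleigh quotients. The maximum of a quadratic form on the unit sphere is
    attained, at an eigenvector (quad_rayleigh). This gives the bound by
    lambda_max, and, applied to the opposite of a Gram matrix, the coercivity
    that makes the operator norm a finite supremum (hnorm_image_le). *)

(** * Measures with densities *)

Section image_measure.
Context d1 d2 (T1 : measurableType d1) (T2 : measurableType d2) {K : realType}.

(** The pushforward, packaged with its measure structure when the measurability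
    of the function is a hypothesis rather than part of its type. *)
Definition image_measure (m : {measure set T1 -> \bar K}) (f : T1 -> T2)
  (mf : measurable_fun setT f) : {measure set T2 -> \bar K}.
Proof. by refine (pushforward m f). Defined.

End image_measure.

Section density.
Local Open Scope ereal_scope.
Context d (T : measurableType d) {K : realType}.
Variables (mu m : {measure set T -> \bar K}) (f : T -> K).
Hypotheses (mf : measurable_fun setT f) (f0 : forall x, (0 <= f x)%R).
Hypothesis mE : forall C, measurable C -> m C = \int[mu]_(x in C) (f x)%:E.

Import HBNNSimple.

Let nnsfun_density (h : {nnsfun T >-> K}) :
  \int[m]_x (h x)%:E = \int[mu]_x ((h x)%:E * (f x)%:E).
Proof.
have mh r : measurable (h @^-1` [set r]) by exact: measurable_funPTI.
have h0 r y : 0 <= (r * \1_(h @^-1` [set r]) y)%:E.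
  by rewrite EFinM; exact: nnfun_muleindic_ge0.
under eq_integral do rewrite fimfunE -fsumEFin//.
under [RHS]eq_integral.
  move=> x _; rewrite fimfunE -fsumEFin//.
  rewrite ge0_mule_fsuml; last by [].
  over.
rewrite !ge0_integral_fsum//=.
- apply: eq_fsbigr => r rh.
  have [x _ hx] := set_mem rh.
  have r0 : (0 <= r)%R by rewrite -hx.
  transitivity (r%:E * m (h @^-1` [set r])).
    by rewrite integralZl_indic_nnsfun// integral_indic// setIT.
  rewrite mE// (integral_mkcond (_ @^-1` _)) -ge0_integralZl//=.
  + apply: eq_integral => y _; rewrite patchE indicE.
    by case: ifPn => yr; rewrite ?mulr1 ?mulr0 ?mul0e ?mule0.
  + apply/(measurable_restrictT _ (mh r)).
    by apply: measurable_funTS; exact/measurable_EFinP.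
  + by move=> y _; rewrite patchE; case: ifPn => //; rewrite lee_fin.
- move=> r; apply: emeasurable_funM; last exact/measurable_EFinP.
  by apply/measurable_EFinP; apply: measurable_funM.
- by move=> r y _; apply: mule_ge0; [exact: h0|rewrite lee_fin].
- by move=> r; apply/measurable_EFinP; apply: measurable_funM.
Qed.

(** Simple functions reduce the claim to indicators, where it is the definition
    of a density; monotone convergence does the rest. *)
Lemma ge0_integral_density (h : T -> \bar K) :
  measurable_fun setT h -> (forall x, 0 <= h x) ->
  \int[m]_x h x = \int[mu]_x (h x * (f x)%:E).
Proof.
move=> mh h0; pose h_ := nnsfun_approx measurableT mh.
have cvgh x : EFin \o h_ ^~ x @ \oo --> h x by exact: cvg_nnsfun_approx.
transitivity (limn (fun n => \int[m]_x (h_ n x)%:E)).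
  rewrite -monotone_convergence//.
  - by apply: eq_integral => x _; apply/esym/cvg_lim => //; exact: cvgh.
  - by move=> n; exact/measurable_EFinP/measurable_funP.
  - by move=> n x _; rewrite lee_fin.
  - by move=> x _ p n pn; rewrite lee_fin; exact/lefP/nd_nnsfun_approx.
under eq_fun do rewrite nnsfun_density.
rewrite -monotone_convergence//.
- by apply: eq_integral => x _; apply/cvg_lim => //; apply: cvgeZr => //; exact: cvgh.
- by move=> n; apply: emeasurable_funM; exact/measurable_EFinP.
- by move=> n x _; rewrite mule_ge0// lee_fin.
- move=> x _ p n pn; rewrite lee_wpmul2r// lee_fin//.
  exact/lefP/nd_nnsfun_approx.
Qed.

End density.

(** * Substitutions on the line and in the plane *)

Section affine.
Context {K : realType}.
Local Notation mu := (@lebesgue_measure K).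
Local Open Scope ereal_scope.

(** The image of the Lebesgue measure under x |-> a * x + b, rescaled by |a|,
    gives intervals their length, hence is the Lebesgue measure. *)
Lemma ge0_integral_affine (f : K -> \bar K) (a b : K) : a != 0%R ->
  measurable_fun setT f -> (forall x, 0 <= f x) ->
  \int[mu]_x f (a * x + b)%R = (`|a|^-1)%:E * \int[mu]_x f x.
Proof.
move=> a0 mf f0.
pose phi : measurableTypeR K -> measurableTypeR K := fun x => (a * x + b)%R.
have mphi : measurable_fun setT phi.
  by apply: measurable_funD => //; exact: measurable_funM.
have na0 : (0 <= `|a|)%R by [].
pose nu := mscale (NngNum na0) (image_measure mu mphi).
have nuE A : measurable A -> nu A = mu A.
  move=> mA; apply/esym/lebesgue_measure_unique => //= _ [[x y]] _ <-.
  rewrite /nu /mscale/= /pushforward.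
  have [ap|an] := ltP 0%R a; last have {}an : (a < 0)%R by rewrite lt_neqAle a0.
    rewrite (_ : _ @^-1` _ = `]((x - b) / a)%R, ((y - b) / a)%R])%classic; last first.
      apply/seteqP; split => z /=; rewrite !in_itv/= /phi;
      by rewrite ltr_pdivrMr// ler_pdivlMr// ltrBlDr lerBrDr (mulrC z).
    rewrite !lebesgue_measure_itv/= !lte_fin ltr_pM2r ?invr_gt0// ltrD2r.
    case: ifPn => _; last by rewrite mule0.
    by rewrite -!EFinB -EFinM gtr0_norm//; congr EFin; field.
  rewrite (_ : _ @^-1` _ = `[((y - b) / a)%R, ((x - b) / a)%R[)%classic; last first.
    apply/seteqP; split => z /=; rewrite !in_itv/= /phi => /andP[p1 p2];
    move: p1 p2;
    rewrite ?ltr_ndivlMr// ?ler_ndivrMr// ?ltrBlDr ?lerBrDr ?ltrBrDr ?lerBlDr (mulrC a);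
    by move=> -> ->.
  rewrite !lebesgue_measure_itv/= !lte_fin ltr_nM2r ?invr_lt0// ltrD2r.
  case: ifPn => _; last by rewrite mule0.
  by rewrite -!EFinB -EFinM ltr0_norm//; congr EFin; field.
transitivity (\int[pushforward mu phi]_x f x).
  by rewrite ge0_integral_pushforward.
transitivity ((`|a|^-1)%:E * \int[nu]_x f x); last first.
  congr (_ * _); apply: eq_measure_integral => A mA _.
  exact: nuE.
rewrite ge0_integral_mscale//= muleA -EFinM mulVf ?mul1e//.
by rewrite normr_eq0.
Qed.

End affine.

Section planar_integrals.
Context {K : realType}.
Local Notation mu := (@lebesgue_measure K).
Local Notation G := (measurableTypeR K).
Local Open Scope ereal_scope.

(** Since c is nonzero, the substitution u = c * x + s * y in the inner integral
    over x turns c * y - s * x into (y - s * u) / c; after exchanging the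
    integrals, the substitution v = (y - s * u) / c in y undoes the factor
    introduced by the first one. *)
Lemma ge0_integral_rotation (F : K * K -> \bar K) (c s : K) : c != 0%R ->
  (c ^+ 2 + s ^+ 2 = 1)%R -> measurable_fun setT F -> (forall z, 0 <= F z) ->
  \int[mu]_x \int[mu]_y F (c * x + s * y, c * y - s * x)%R =
  \int[mu]_x \int[mu]_y F (x, y).
Proof.
move=> c0 cs mF F0.
pose H (z : K * K) := F (z.1, c^-1 * z.2 + - (s * z.1 / c))%R.
have mH : measurable_fun setT H.
  apply: measurableT_comp => //; apply: measurable_fun_pair => //.
  apply: measurable_funD; first exact: measurable_funM.
  apply: measurableT_comp => //; apply: measurable_funM => //.
  exact: measurable_funM.
pose G (z : K * K) := F (c * z.1 + s * z.2, c * z.2 - s * z.1)%R.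
have mG : measurable_fun setT G.
  apply: measurableT_comp => //; apply: measurable_fun_pair.
    by apply: measurable_funD; exact: measurable_funM.
  by apply: measurable_funB; exact: measurable_funM.
rewrite [LHS](fubini_tonelli (m1 := mu) (m2 := mu) G mG); last first.
  by move=> z; exact: F0.
transitivity ((`|c|^-1)%:E * \int[mu]_y \int[mu]_x H (x, y)).
  rewrite -ge0_integralZl//; first last.
  - by move=> y _; apply: integral_ge0 => x _; exact: F0.
  - exact: (measurable_fun_fubini_tonelli_G (m1 := mu) H mH (fun z => F0 _)).
  apply: eq_integral => y _.
  rewrite -(@ge0_integral_affine _ (fun x => H (x, y)) c (s * y))//; first last.
  - by move=> x; exact: F0.
  - exact: measurable_fun_pair1.
  apply: eq_integral => x _; rewrite /H/=; congr (F (_, _)).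
  have -> : (c * y - s * x = (c ^+ 2 * y - s * c * x) / c)%R by field.
  have -> : (c ^+ 2 = 1 - s ^+ 2)%R by rewrite -cs addrK.
  by field.
rewrite -(fubini_tonelli (m1 := mu) (m2 := mu) H mH); last first.
  by move=> z; exact: F0.
rewrite -ge0_integralZl//; first last.
- by move=> x _; apply: integral_ge0 => y _; exact: F0.
- exact: (measurable_fun_fubini_tonelli_F (m2 := mu) H mH (fun z => F0 _)).
apply: eq_integral => x _; rewrite /H/=.
rewrite (@ge0_integral_affine _ (fun y => F (x, y)))//; first last.
- exact: measurable_fun_pair2.
- by rewrite invr_eq0.
by rewrite normfV invrK muleA -EFinM mulVf ?mul1e// normr_eq0.
Qed.

Lemma product_densityE (m1 m2 : {sigma_finite_measure set measurableTypeR K -> \bar K})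
    (f1 f2 : K -> K) :
  measurable_fun setT f1 -> (forall x, 0 <= f1 x)%R ->
  measurable_fun setT f2 -> (forall x, 0 <= f2 x)%R ->
  (forall C, measurable C -> m1 C = \int[mu]_(x in C) (f1 x)%:E) ->
  (forall C, measurable C -> m2 C = \int[mu]_(x in C) (f2 x)%:E) ->
  forall D : set (G * G), measurable D ->
  (m1 \x m2) D = \int[mu]_x \int[mu]_y (f1 x * f2 y * \1_D (x, y))%:E.
Proof.
move=> mf1 f10 mf2 f20 m1E m2E D mD.
rewrite /product_measure1 (ge0_integral_density (T := measurableTypeR K) mf1 f10 m1E)//; last first.
  exact: measurable_fun_xsection.
apply: eq_integral => x _ /=.
have mDx : measurable (xsection D x) by exact: measurable_xsection.
rewrite m2E// integral_mkcond muleC -ge0_integralZl//; first last.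
- by rewrite lee_fin.
- by move=> y _; rewrite patchE; case: ifPn => //; rewrite lee_fin.
- apply/(measurable_restrictT _ mDx).
  by apply: measurable_funTS; exact/measurable_EFinP.
apply: eq_integral => y _; rewrite patchE mem_xsection indicE.
by case: ifPn => _; rewrite ?mule0 ?mulr0// mulr1 EFinM.
Qed.

(** The density of the product law is a function of x^2 + y^2, which the
    rotation preserves. *)
Lemma normal_prob_rotation (c s : K) (A B : set G) : c != 0%R ->
  (c ^+ 2 + s ^+ 2 = 1)%R -> measurable A -> measurable B ->
  (normal_prob 0 1 \x normal_prob 0 1)
    [set z : G * G | A (c * z.1 + s * z.2)%R /\ B (c * z.2 - s * z.1)%R] =
  normal_prob 0 1 A * normal_prob 0 1 B.
Proof.
move=> c0 cs mA mB.
pose phi : K -> K := normal_pdf 0 1.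
have mphi : measurable_fun setT phi by exact: measurable_normal_pdf.
have phi0 x : (0 <= phi x)%R by exact: normal_pdf_ge0.
pose g : probability G K := normal_prob 0 1.
have gE C : measurable C -> g C = \int[mu]_(x in C) (phi x)%:E by [].
have ggE := product_densityE mphi phi0 mphi phi0 gE gE.
have mAB : measurable (A `*` B) by exact: measurableX.
pose rot (z : G * G) : G * G := (c * z.1 + s * z.2, c * z.2 - s * z.1)%R.
have mrot : measurable_fun setT rot.
  apply: measurable_fun_pair.
    by apply: measurable_funD; exact: measurable_funM.
  by apply: measurable_funB; exact: measurable_funM.
have mrotAB : measurable (rot @^-1` (A `*` B)).
  by rewrite -[X in measurable X]setTI; exact: mrot.
have <- := product_measure1E g g mA mB.
transitivity ((g \x g) (rot @^-1` (A `*` B))); first by [].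
rewrite (ggE _ mAB) (ggE _ mrotAB).
pose F (z : K * K) := (phi z.1 * phi z.2 * \1_(A `*` B) z)%:E.
have mF : measurable_fun setT F.
  apply/measurable_EFinP; apply: measurable_funM; last exact: measurable_indic.
  by apply: measurable_funM; exact: measurableT_comp.
have F0 z : 0 <= F z by rewrite lee_fin !mulr_ge0.
have <- : \int[mu]_x \int[mu]_y F (x, y) =
    \int[mu]_x \int[mu]_y (phi x * phi y * \1_(A `*` B) (x, y))%:E by [].
rewrite -(ge0_integral_rotation c0 cs mF F0).
apply: eq_integral => x _; apply: eq_integral => y _.
congr EFin; congr (_ * _)%R.
rewrite /phi !normal_pdfE ?oner_neq0//= /normal_fun !mulrA.
rewrite ![(normal_peak 1 * _ * normal_peak 1)%R]mulrAC -!mulrA -!expRD.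
do 2 congr (_ * _)%R; congr expR.
rewrite -!mulrDl; congr (_ / _)%R.
rewrite !subr0 -!opprD; congr (- _)%R.
transitivity ((c ^+ 2 + s ^+ 2) * (x ^+ 2 + y ^+ 2))%R; last by ring.
by rewrite cs mul1r.
Qed.

End planar_integrals.

(** * Gamma laws and the incomplete gamma function *)

Section gamma_laws.
Context {K : realType}.
Local Notation mu := (@lebesgue_measure K).
Local Notation G := (measurableTypeR K).

Definition gamma_fun (a t : K) : K :=
  t `^ (a - 1) * expR (- t) * \1_`]0, +oo[ t.

Lemma measurable_gamma_fun a : measurable_fun setT (gamma_fun a).
Proof.
apply: measurable_funM; last exact: measurable_indic.
apply: measurable_funM; first exact: measurable_powR.
by apply: measurableT_comp => //; exact: measurableT_comp.
Qed.

Lemma gamma_fun_ge0 a t : 0 <= gamma_fun a t.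
Proof. by rewrite !mulr_ge0 ?powR_ge0 ?expR_ge0. Qed.

(** The Gamma(a) law with unit scale. The constant is left unspecified: for a
    probability it is determined by the total mass. *)
Definition gamma_law (a : K) (nu : set K -> \bar K) :=
  exists2 c : K, 0 <= c &
    forall C, measurable C -> nu C = (\int[mu]_(t in C) (c * gamma_fun a t)%:E)%E.

Let measurable_Mgamma (c a : K) : measurable_fun setT (fun t => c * gamma_fun a t).
Proof. by apply: measurable_funM => //; exact: measurable_gamma_fun. Qed.

Let Mgamma_ge0 (c a t : K) : 0 <= c -> 0 <= c * gamma_fun a t.
Proof. by move=> c0; rewrite mulr_ge0// gamma_fun_ge0. Qed.

(** The substitution behind the Beta integral: with s = u * v and
    t = u - s, the product of the densities at s and t splits into a function of
    u and a function of v. *)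
Lemma gamma_fun_split (a b u v : K) : 0 < u ->
  gamma_fun a (u * v) * gamma_fun b (- (u * v) + u) * u =
  gamma_fun (a + b) u * (v `^ (a - 1) * (1 - v) `^ (b - 1) * \1_`]0, 1[ v).
Proof.
move=> u0; rewrite /gamma_fun !indicE !mem_setE !in_itv/= !andbT.
have uv : - (u * v) + u = u * (1 - v) by ring.
rewrite uv !pmulr_rgt0// subr_gt0 u0.
have [v0|v0] /= := ltP 0 v; last by rewrite !(mul0r, mulr0).
have [v1|v1] /= := ltP v 1; last by rewrite !(mul0r, mulr0).
rewrite !powRM ?ltW ?subr_gt0//.
have -> : expR (- u) = expR (- (u * v)) * expR (- (u * (1 - v))).
  by rewrite -expRD; congr expR; ring.
have -> : u `^ (a + b - 1) = u `^ (a - 1) * u `^ (b - 1) * u.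
  have u1 : u != 0 by rewrite gt_eqF.
  rewrite -[X in _ = _ * X](powRr1 (ltW u0)) -!powRD ?u1 ?implybT//.
  by congr (_ `^ _); ring.
by ring.
Qed.

(** Convolution: with u = s + t and s = u * v the double integral becomes a
    product, by gamma_fun_split. The v-integral kappa is a multiple of a Beta
    value; it is finite because the total mass is 1. *)
Lemma gamma_lawD (a b : K) (nu1 nu2 : probability G K) :
  gamma_law a nu1 -> gamma_law b nu2 ->
  gamma_law (a + b) (fun C => (nu1 \x nu2)%E [set z | C (z.1 + z.2)]).
Proof.
move=> [c1 c10 nu1E] [c2 c20 nu2E].
pose f1 t := c1 * gamma_fun a t; pose f2 t := c2 * gamma_fun b t.
have mf1 : measurable_fun setT f1 by exact: measurable_Mgamma.
have mf2 : measurable_fun setT f2 by exact: measurable_Mgamma.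
pose beta v := c1 * c2 * (v `^ (a - 1) * (1 - v) `^ (b - 1) * \1_`]0, 1[ v).
have mbeta : measurable_fun setT beta.
  apply: measurable_funM => //; apply: measurable_funM; last exact: measurable_indic.
  apply: measurable_funM; first exact: measurable_powR.
  have m1 : measurable_fun setT (fun v : K => 1 - v) by exact: measurable_funB.
  exact: (measurableT_comp (measurable_powR (b - 1)) m1).
have beta0 v : 0 <= beta v by rewrite /beta !mulr_ge0 ?powR_ge0.
pose kappa := (\int[mu]_v (beta v)%:E)%E.
have kappa0 : (0 <= kappa)%E by apply: integral_ge0 => v _; rewrite lee_fin.
pose add (z : G * G) : G := z.1 + z.2.
have madd : measurable_fun setT add by exact: measurable_funD.
have prodE := @product_densityE _ nu1 nu2 f1 f2
  (measurable_Mgamma _ _) (fun x => Mgamma_ge0 _ _ c10)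
  (measurable_Mgamma _ _) (fun x => Mgamma_ge0 _ _ c20) nu1E nu2E.
have main C : measurable C -> (nu1 \x nu2)%E (add @^-1` C) =
    (kappa * \int[mu]_(u in C) (gamma_fun (a + b) u)%:E)%E.
  move=> mC.
  have mD : measurable (add @^-1` C).
    by rewrite -[X in measurable X]setTI; exact: madd.
  rewrite (prodE _ mD).
  pose H (z : K * K) := (f1 z.1 * f2 (- z.1 + z.2) * \1_C z.2)%:E.
  have H0 z : (0 <= H z)%E.
    by rewrite lee_fin; apply: mulr_ge0 => //; apply: mulr_ge0; exact: Mgamma_ge0.
  have mH : measurable_fun setT H.
    apply/measurable_EFinP; apply: measurable_funM; last first.
      by apply: measurableT_comp => //; exact: measurable_indic.
    apply: measurable_funM; first exact: (measurableT_comp mf1).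
    apply: (measurableT_comp mf2); apply: measurable_funD => //.
    exact: measurableT_comp.
  transitivity (\int[mu]_x \int[mu]_u H (x, u))%E.
    apply: eq_integral => x _.
    have := @ge0_integral_affine _ (fun u => H (x, u)) 1 x (oner_neq0 _).
    rewrite normr1 invr1 mul1e => <-; first last.
    - by move=> u; exact: H0.
    - exact: measurable_fun_pair2.
    apply: eq_integral => y _; rewrite /H/= mul1r (addrC y) addKr.
    by congr (_ * _)%:E; rewrite !indicE; congr (nat_of_bool _)%:R; apply/idP/idP; rewrite !inE.
  rewrite (fubini_tonelli (m1 := mu) (m2 := mu) H mH H0).
  rewrite (integral_mkcond C) -ge0_integralZl//; first last.
  - by move=> u _; rewrite patchE; case: ifPn => // _; rewrite lee_fin gamma_fun_ge0.
  - apply/(measurable_restrictT _ mC)/measurable_funTS/measurable_EFinP.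
    exact: measurable_gamma_fun.
  apply: eq_integral => u _; rewrite patchE.
  (* For u <= 0 one of the two densities vanishes, at x or at u - x. *)
  have [u0|u0] := ltP 0 u; last first.
    rewrite integral0_eq => [|x _]; last first.
      rewrite /H/=; congr EFin; rewrite /f1 /f2 /gamma_fun !indicE !mem_setE !in_itv/= !andbT.
      have [x0|] := ltP 0 x; last by rewrite !(mulr0, mul0r).
      rewrite (_ : (0 < - x + u) = false) ?(mulr0, mul0r)//.
      by apply/negbTE; rewrite -leNgt addrC subr_le0 (le_trans u0)// ltW.
    case: ifPn => _; last by rewrite mule0.
    by rewrite /gamma_fun indicE mem_setE in_itv/= ltNge u0 mulr0 mule0.
  have := @ge0_integral_affine _ (fun x => H (x, u)) u 0 (lt0r_neq0 u0).
  rewrite gtr0_norm// => /(_ _ _)/(congr1 (fun z => u%:E * z)%E).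
  rewrite muleA -EFinM divff ?lt0r_neq0// mul1e => <-; first last.
  - by move=> x; exact: H0.
  - exact: measurable_fun_pair1.
  rewrite -ge0_integralZl//; first last.
  - by rewrite lee_fin ltW.
  - apply: (measurableT_comp (f := fun x => H (x, u))).
      exact: measurable_fun_pair1.
    by apply: measurable_funD => //; exact: measurable_funM.
  rewrite muleC -ge0_integralZl//; first last.
  - by case: ifPn => // _; rewrite lee_fin gamma_fun_ge0.
  - by move=> x _; rewrite lee_fin.
  - exact/measurable_EFinP.
  apply: eq_integral => v _; rewrite /H/= addr0 indicE.
  case: ifPn => uC; last by rewrite mulr0 mule0 mul0e.
  rewrite -!EFinM mulr1; congr EFin; rewrite /f1 /f2 /beta.
  transitivity (c1 * c2 * (gamma_fun a (u * v) * gamma_fun b (- (u * v) + u) * u)).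
    by ring.
  by rewrite gamma_fun_split//; ring.
have tot : (kappa * \int[mu]_u (gamma_fun (a + b) u)%:E = 1)%E.
  rewrite -main//; transitivity ((nu1 \x nu2)%E (setT `*` setT)).
    by congr (_ _); apply/seteqP; split.
  rewrite [LHS](product_measure1E nu1 nu2 measurableT measurableT).
  rewrite [X in (X * _)%E](probability_setT nu1).
  by rewrite [X in (_ * X)%E](probability_setT nu2) mule1.
(* An infinite kappa would make the total mass 0 or infinite. *)
have kfin : kappa \is a fin_num.
  rewrite ge0_fin_numE// ltey; apply/eqP => koo; move: tot; rewrite koo.
  set I := (\int[mu]_u _)%E.
  have : (0 <= I)%E by apply: integral_ge0 => u _; rewrite lee_fin gamma_fun_ge0.
  rewrite le_eqVlt => /predU1P[<-|I0].
    by rewrite mule0 => /eqP; rewrite eqe eq_sym oner_eq0.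
  by rewrite gt0_mulye.
exists (fine kappa); first exact: fine_ge0.
move=> C mC; rewrite main// -{1}(fineK kfin) -ge0_integralZl//; last 3 first.
- by apply/measurable_EFinP/measurable_funTS; exact: measurable_gamma_fun.
- by move=> x _; rewrite lee_fin gamma_fun_ge0.
- by rewrite lee_fin fine_ge0.
Qed.

End gamma_laws.

Section gamma_half.
Context {K : realType}.
Local Notation mu := (@lebesgue_measure K).
Local Notation G := (measurableTypeR K).

Lemma sqrtM2_derive1 (t : K) : 0 < t ->
  is_derive t 1 (fun t : K => Num.sqrt (2 * t)) (Num.sqrt (2 * t))^-1.
Proof.
move=> t0; have t20 : 0 < 2 * t by rewrite mulr_gt0.
have : is_derive t 1 (Num.sqrt \o (fun t : K => 2 * t)) ((2 * Num.sqrt (2 * t))^-1 * (2 * 1)).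
  apply: is_derive1_comp.
  exact: is_derive1_sqrt.
by move=> dF; apply: is_derive_eq dF _; rewrite mulr1 invfM mulrAC mulVf// mul1r.
Qed.

Lemma sqrtM2_cvgy : (fun t : K => Num.sqrt (2 * t)) t @[t --> +oo%R] --> +oo%R.
Proof.
apply/cvgryPge => A; near=> t.
have A0 : 0 <= `|A| by [].
rewrite (le_trans (ler_norm A))// -(ger0_norm A0) -sqrtr_sqr ler_wsqrtr//.
rewrite -ler_pdivrMl//; near: t; exact: nbhs_pinfty_ge.
Unshelve. all: by end_near. Qed.

(** Substitution y = sqrt (2 * t). The half-line stays away from 0 because
    the derivative of the substitution is unbounded there. *)
Lemma gamma_half_tail (a : K) : 0 < a ->
  (\int[mu]_(y in `[Num.sqrt (2 * a), +oo[) (normal_pdf 0 1 y)%:E =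
   \int[mu]_(t in `[a, +oo[)
     (normal_peak 1 / Num.sqrt 2 * gamma_fun (1/2) t)%:E)%E.
Proof.
move=> a0.
pose F (t : K) : K := Num.sqrt (2 * t).
have dF (t : K) : 0 < t -> is_derive t 1 F (Num.sqrt (2 * t))^-1.
  exact: sqrtM2_derive1.
have F'E (t : K) : 0 < t -> derive1 F t = (Num.sqrt (2 * t))^-1.
  by move=> t0; rewrite derive1E; apply: derive_val; exact: dF.
rewrite -[Num.sqrt (2 * a)]/(F a).
have gta (t : K) : a <= t -> 0 < t by exact: lt_le_trans.
have F'cont (t : K) : 0 < t -> derive1 F x @[x --> t] --> derive1 F t.
  move=> t0; rewrite F'E//.
  apply: (@cvg_trans _ ((fun x : K => (Num.sqrt (2 * x))^-1) @ t)).
    apply: near_eq_cvg; near=> x; rewrite F'E//.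
    by near: x; exact: lt_nbhsr.
  have st : F t != 0 by rewrite gt_eqF// sqrtr_gt0 mulr_gt0.
  suff cF : F x @[x --> t] --> F t by exact: cvgV st cF.
  apply: (cvg_comp (fun t : K => 2 * t) Num.sqrt); last exact: sqrt_continuous.
  by apply: cvgM; [exact: cvg_cst|exact: cvg_id].
rewrite (@increasing_ge0_integration_by_substitutiony _ F (normal_pdf 0 1 : K -> K) a).
- apply: eq_integral => t; rewrite inE/= in_itv/= andbT => at_.
  have t0 := gta _ at_.
  congr EFin; rewrite !fctE/= F'E// normal_pdfE ?oner_neq0//= /normal_fun /gamma_fun.
  rewrite indicE mem_setE in_itv/= t0 mulr1.
  rewrite /F subr0 sqr_sqrtr ?mulr_ge0 ?ltW// expr1n.
  have -> : - (2 * t) / 2%:R = - t by field.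
  rewrite sqrtrM ?ler0n // invfM.
  have -> : t `^ (1 / 2 - 1) = (Num.sqrt t)^-1.
    by rewrite -powR12_sqrt ?ltW// -powRN; congr (_ `^ _); field.
  by ring.
- move=> x y; rewrite !in_itv/= !andbT => ax ay xy.
  have y0 : 0 < 2 * y by rewrite mulr_gt0 ?(gta y).
  by rewrite /F (ltr_sqrt _ y0) ltr_pM2l.
- by move=> x; rewrite in_itv/= andbT => ax; apply: F'cont; rewrite gta// ltW.
- apply/cvg_ex; exists (derive1 F a).
  by apply: cvg_at_right_filter; exact: F'cont.
- apply/cvg_ex; exists 0.
  apply: (@cvg_trans _ ((fun x : K => (Num.sqrt (2 * x))^-1) x @[x --> +oo%R])).
    apply: near_eq_cvg; near=> x.
    have x0 : 0 < x by near: x; exact: nbhs_pinfty_gt.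
    by rewrite F'E.
  have Fgt0 : \forall x \near +oo%R, 0 < F x.
    near=> x; have x0 : 0 < x by near: x; exact: nbhs_pinfty_gt.
    by rewrite sqrtr_gt0 mulr_gt0.
  exact/(gtr0_cvgV0 Fgt0)/sqrtM2_cvgy.
- split.
    move=> x; rewrite in_itv/= andbT => ax.
    by have [] := dF _ (gta _ (ltW ax)).
  apply: cvg_at_right_filter.
  apply: (cvg_comp (fun t : K => 2 * t) Num.sqrt); last exact: sqrt_continuous.
  by apply: cvgM; [exact: cvg_cst|exact: cvg_id].
- exact: sqrtM2_cvgy.
- apply: continuous_subspaceT => x; exact: continuous_normal_pdf.
- by move=> x _; exact: normal_pdf_ge0.
Unshelve. all: by end_near. Qed.

End gamma_half.

Section gamma_half_law.
Context {K : realType}.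
Local Notation mu := (@lebesgue_measure K).
Local Notation G := (measurableTypeR K).
Local Notation half_sqr := (fun y : K => y ^+ 2 / 2).

Lemma measurable_half_sqr : measurable_fun setT (half_sqr : G -> G).
Proof. by apply: measurable_funM => //; exact: measurable_funX. Qed.

(* The factor 2 accounts for the two square roots +y and -y. *)
Let c : K := 2 * (normal_peak 1 / Num.sqrt 2).

Let c0 : 0 <= c.
Proof. by rewrite mulr_ge0// divr_ge0 ?normal_peak_ge0 ?sqrtr_ge0. Qed.

Let normal_half_sqr_tail (a : K) : 0 < a ->
  normal_prob 0 1 (half_sqr @^-1` `[a, +oo[) =
  (\int[mu]_(t in `[a, +oo[) (c * gamma_fun (1 / 2) t)%:E)%E.
Proof.
move=> a0; pose s := Num.sqrt (2 * a).
have s0 : 0 < s by rewrite sqrtr_gt0 mulr_gt0.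
have mphi D : measurable_fun D (fun y => (@normal_pdf K 0 1 y)%:E).
  by apply/measurable_EFinP/measurable_funTS; exact: measurable_normal_pdf.
have phi0 (y : K) : (0 <= (normal_pdf 0 1 y)%:E)%E by rewrite lee_fin normal_pdf_ge0.
have -> : half_sqr @^-1` `[a, +oo[ = `]-oo, - s] `|` `[s, +oo[.
  apply/seteqP; split => y /=; rewrite !in_itv/= !andbT ler_pdivlMr//.
    rewrite mulrC -ler_sqrt ?sqr_ge0// sqrtr_sqr -/s ler_normr => /orP[->|].
      by right.
    by rewrite lerNr; left.
  move=> ys; rewrite mulrC -ler_sqrt ?sqr_ge0// sqrtr_sqr -/s ler_normr.
  by case: ys => [|->//]; rewrite lerNr => ->; rewrite orbT.
rewrite /normal_prob ge0_integral_setU//=; last first.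
  apply/disj_set2P/seteqP; split => // y /=; rewrite !in_itv/= andbT => -[ys sy].
  by have := le_trans sy ys; lra.
  exact: mphi.
have -> : (\int[mu]_(y in `]-oo, (- s)%R]) (normal_pdf 0 1 y)%:E =
           \int[mu]_(y in `[s, +oo[) (normal_pdf 0 1 y)%:E)%E.
  rewrite integral_mkcond [RHS]integral_mkcond.
  rewrite -[RHS]mul1e.
  have /ge0_integral_affine : (-1 : K) != 0 by rewrite oppr_eq0 oner_eq0.
  move=> /(_ ((fun y => (normal_pdf 0 1 y)%:E) \_ `[s, +oo[) 0).
  rewrite normrN1 invr1 => <-; first last.
  - by move=> y; rewrite patchE; case: ifPn.
  - apply/(measurable_restrictT _ (measurable_itv _)); exact: mphi.
  apply: eq_integral => y _; rewrite !patchE mulN1r addr0 !mem_setE !in_itv/= andbT.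
  rewrite lerNr; case: ifPn => // _; congr EFin.
  rewrite !normal_pdfE ?oner_neq0//= /normal_fun !subr0.
  rewrite sqrrN.
reflexivity.
rewrite [X in (X + _)%E](gamma_half_tail a0) [X in (_ + X)%E](gamma_half_tail a0).
rewrite -ge0_integralD//.
- by apply: eq_integral => t _; rewrite -EFinD /c; congr EFin; ring.
- move=> t _; rewrite lee_fin mulr_ge0 ?gamma_fun_ge0//.
  by rewrite divr_ge0 ?normal_peak_ge0 ?sqrtr_ge0.
- apply/measurable_EFinP/measurable_funTS/measurable_funM => //.
  exact: measurable_gamma_fun.
- move=> t _; rewrite lee_fin mulr_ge0 ?gamma_fun_ge0//.
  by rewrite divr_ge0 ?normal_peak_ge0 ?sqrtr_ge0.
- apply/measurable_EFinP/measurable_funTS/measurable_funM => //.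
  exact: measurable_gamma_fun.
Qed.

(** Both sides are measures, so it is enough to compare them on the half-lines
    [x, +oo[. For x > 0 this is the substitution; the case x <= 0 reduces to
    ]0, +oo[, which is an increasing union of such half-lines. *)
Lemma gamma_law_half_sqr :
  gamma_law (1 / 2) (pushforward (normal_prob 0 1) (half_sqr : G -> G)).
Proof.
exists c => // C mC.
pose f t := (c * gamma_fun (1 / 2) t)%:E.
have f0 t : (0 <= f t)%E by rewrite lee_fin mulr_ge0// gamma_fun_ge0.
have mf : measurable_fun setT f.
  by apply/measurable_EFinP/measurable_funM => //; exact: measurable_gamma_fun.
pose m1 := image_measure (normal_prob 0 1 : {measure set G -> \bar K})
  measurable_half_sqr.
pose nu (A : set G) := (\int[mu]_(t in A) f t)%E.
have nu0 : nu set0 = 0%E by rewrite /nu integral_set0.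
have nu_ge0 A : (0 <= nu A)%E by exact: integral_ge0.
have nu_add : semi_sigma_additive nu by exact: semi_sigma_additive_nng_induced.
pose m2 : {measure set G -> \bar K} :=
  HB.pack nu (isMeasure.Build _ _ _ nu nu0 nu_ge0 nu_add).
pose halfline (x : K) : set G := [set` `[x, +oo[].
have m12_pos (x : K) : 0 < x -> m1 (halfline x) = m2 (halfline x).
  exact: normal_half_sqr_tail.
have m12_0 : m1 `]0, +oo[%classic = m2 `]0, +oo[%classic.
  pose F n := halfline (0 + n.+1%:R^-1).
  have FE : `]0, +oo[%classic = \bigcup_n F n by rewrite itvoyEbigcup.
  have ndF : nondecreasing_seq F.
    move=> n m nm; apply/subsetPset => x /=; rewrite /F/halfline/= !in_itv/= !andbT.
    by apply: le_trans; rewrite lerD2l lef_pV2 ?posrE// ler_nat.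
  have mF n : measurable (F n) by exact: measurable_itv.
  have mUF : measurable (\bigcup_n F n) by exact: bigcupT_measurable.
  have c1 := nondecreasing_cvg_mu (mu := m1) mF mUF ndF.
  have c2 := nondecreasing_cvg_mu (mu := m2) mF mUF ndF.
  rewrite FE; apply: cvg_unique c1 _ => //.
  rewrite (_ : m1 \o F = m2 \o F)//; apply/funext => n /=.
  by apply: m12_pos; rewrite add0r.
have m12 (x : K) : m1 (halfline x) = m2 (halfline x).
  have [/m12_pos//|x0] := ltP 0 x.
  have -> : m2 (halfline x) = m2 `]0, +oo[%classic.
    rewrite /m2/= /nu integral_mkcond [RHS]integral_mkcond.
    apply: eq_integral => t _; rewrite !patchE !mem_setE !in_itv/= !andbT.
    have [t0|t0] := ltP 0 t; first by rewrite (le_trans x0)// ltW.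
    case: ifPn => // _; rewrite /f /gamma_fun indicE mem_setE in_itv/= ltNge t0.
    by rewrite !mulr0.
  rewrite -m12_0 /m1/= /pushforward.
  have -> : half_sqr @^-1` halfline x = setT.
    apply/seteqP; split => // y _; rewrite /halfline/= in_itv/= andbT.
    by rewrite (le_trans x0)// divr_ge0 ?sqr_ge0.
  have -> : half_sqr @^-1` `]0, +oo[%classic = setT `\ 0.
    apply/seteqP; split => y /=; rewrite in_itv/= andbT.
      move=> h; split => // y0; move: h.
      by rewrite y0 expr0n/= mul0r ltxx.
    by move=> [_ /eqP y0]; rewrite divr_gt0// exprn_even_gt0.
  rewrite /normal_prob integral_setD1//; first exact: measurableD.
  by apply/measurable_EFinP/measurable_funTS; exact: measurable_normal_pdf.
suff: m1 C = m2 C by [].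
pose g n := halfline (- n%:R).
have uniq := @measure_unique _ K G (@RGenCInfty.G K) g.
apply: (uniq _ _ _ _ m1 m2) => //.
- exact: RGenCInfty.measurableE.
- move=> _ _ [x ->] [y ->]; exists (Num.max x y).
  by apply/seteqP; split => z /=; rewrite !in_itv/= !andbT ge_max => /andP.
- by move=> n; exists (- n%:R).
- apply/seteqP; split => // x _; exists (Num.truncn `|x|).+1 => //=.
  rewrite /g /halfline/= in_itv/= andbT lerNl (le_trans (ler_norm _))// normrN.
  by rewrite ltW// truncnS_gt.
- by move=> _ [x ->]; exact: m12.
- move=> n; apply: (@le_lt_trans _ _ 1%E); last by rewrite ltry.
  apply: (@probability_le1 _ _ _ (normal_prob 0 1 : probability G K)).
  rewrite -[X in measurable X]setTI; apply: measurable_half_sqr => //.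
  exact: measurable_itv.
Qed.

End gamma_half_law.

Section gamma_quantile.
Context {K : realType}.
Local Notation mu := (@lebesgue_measure K).
Local Notation G := (measurableTypeR K).
Variables (a : K) (nu : probability G K).
Hypothesis nu_gamma : gamma_law a nu.

(** The constant of the density is the inverse of the complete gamma integral,
    because the total mass is 1; thus the tail is the normalized integral. *)
Lemma gamma_law_tail (q : K) : 0 <= q -> nu `]q, +oo[%classic = (Qgamma a q)%:E.
Proof.
have [c c0 nuE] := nu_gamma.
pose h (t : K) := t `^ (a - 1) * expR (- t).
have mh D : measurable_fun D (fun t => (h t)%:E).
  apply/measurable_EFinP/measurable_funTS/measurable_funM.
    exact: measurable_powR.
  by apply: measurableT_comp => //; exact: measurableT_comp.
have h0 (t : K) : (0 <= (h t)%:E)%E by rewrite lee_fin mulr_ge0 ?powR_ge0 ?expR_ge0.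
pose I (x : K) := (\int[mu]_(t in `[x, +oo[) (h t)%:E)%E.
have I0 x : (0 <= I x)%E by exact: integral_ge0.
have nu_tail x : 0 <= x -> nu `]x, +oo[%classic = (c%:E * I x)%E.
  move=> x0; rewrite (nuE _ (measurable_itv _)).
  rewrite /I -integral_itv_obnd_cbnd//.
  rewrite -ge0_integralZl//; last exact: mh.
  apply: eq_integral => t; rewrite inE/= in_itv/= andbT => xt.
  rewrite -EFinM /gamma_fun indicE mem_setE in_itv/= andbT.
  by rewrite (le_lt_trans x0 xt) mulr1.
have tot : (c%:E * I 0%R = 1)%E.
  rewrite -nu_tail// -(probability_setT nu) (nuE _ (measurable_itv _)) (nuE _ measurableT).
  rewrite integral_mkcond [RHS]integral_mkcond; apply: eq_integral => t _.
  rewrite !patchE mem_setE in_itv/= andbT in_setT /gamma_fun indicE mem_setE.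
  by rewrite in_itv/= andbT; case: ltP => // _; rewrite !mulr0.
have cp : 0 < c.
  rewrite lt_neqAle c0 andbT eq_sym; apply/eqP => cz; move: tot.
  by rewrite cz mul0e => /eqP; rewrite eqe eq_sym oner_eq0.
have Ifin x : (c%:E * I x < +oo)%E -> I x \is a fin_num.
  move=> cI; rewrite ge0_fin_numE// ltey; apply/eqP => Ioo; move: cI.
  by rewrite Ioo gt0_muley ?lte_fin// ltxx.
move=> q0; rewrite nu_tail// /Qgamma /Rintegral -/(I q) -/(I 0).
have If0 : I 0 \is a fin_num by apply: Ifin; rewrite tot ltry.
have Ifq : I q \is a fin_num.
  apply: Ifin; rewrite -nu_tail//; apply: (@le_lt_trans _ _ 1%E); last by rewrite ltry.
  by apply: probability_le1; exact: measurable_itv.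
have -> : fine (I 0) = c^-1.
  move: tot; rewrite -(fineK If0) -EFinM => -[cI].
  by apply: (mulfI (lt0r_neq0 cp)); rewrite cI divff// lt0r_neq0.
by rewrite invrK mulrC EFinM fineK.
Qed.

(** The distribution function W of the law is an integral with variable upper
    bound, hence continuous; it vanishes at 0 and tends to 1. *)
Lemma Qgamma_surj (y : K) : 0 < y < 1 -> exists x, 0 <= x /\ Qgamma a x = y.
Proof.
move=> /andP[y0 y1]; have [c c0 nuE] := nu_gamma.
pose f t := c * gamma_fun a t.
have f0 t : 0 <= f t by rewrite mulr_ge0// gamma_fun_ge0.
have mf : measurable_fun setT f.
  by apply: measurable_funM => //; exact: measurable_gamma_fun.
have intf : mu.-integrable setT (EFin \o f).
  apply/integrableP; split; first exact/measurable_EFinP.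
  under eq_integral do rewrite /= ger0_norm//.
  by rewrite -nuE// probability_setT ltry.
pose W (x : K) := parameterized_integral mu 0 x f.
have nuW x : nu `]x, +oo[%classic = (1 - W x)%:E.
  have -> : `]x, +oo[%classic = ~` `]-oo, x]%classic :> set G.
    by rewrite setCitvl.
  rewrite probability_setC; last exact: measurable_itv.
  rewrite (nuE _ (measurable_itv _)).
  rewrite EFinB /W /parameterized_integral /Rintegral fineK; last first.
    apply: integrable_fin_num => //.
    exact: (integrableS measurableT).
  congr (_ - _)%E; rewrite [LHS]integral_mkcond [RHS]integral_mkcond.
  apply: eq_integral => t _; rewrite !patchE !mem_setE !in_itv/=.
  have [t0|t0] := leP 0 t => //=.
  case: ifP => // _; rewrite /f /gamma_fun indicE mem_setE in_itv/=.
  by rewrite ltNge (ltW t0) !mulr0.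
have QW x : 0 <= x -> Qgamma a x = 1 - W x.
  by move=> x0; apply: EFin_inj; rewrite -gamma_law_tail// nuW.
have [M M0 WM] : exists2 M, 0 <= M & 1 - y <= W M.
  pose F n : set G := `]n%:R, +oo[%classic.
  have niF : nonincreasing_seq F.
    move=> n m nm; apply/subsetPset => x; rewrite /F/= !in_itv/= !andbT.
    by apply: le_lt_trans; rewrite ler_nat.
  have mF n : measurable (F n) by exact: measurable_itv.
  have F0 : \bigcap_n F n = set0.
    apply/seteqP; split => // x /(_ (Num.truncn `|x|).+1 I); rewrite /F/=.
    rewrite in_itv/= andbT => xx.
    have := lt_trans (truncnS_gt `|x|) xx.
    by rewrite ltNge ler_norm.
  have := @nonincreasing_cvg_mu _ _ _ nu F _ mF _ niF.
  rewrite F0 measure0 => /(_ _ _)/fine_cvgP[].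
  - apply: (@le_lt_trans _ _ 1%E); last by rewrite ltry.
    exact: probability_le1.
  - exact: measurable0.
  move=> _ /cvgrPdist_lt/(_ _ y0)[n _ /(_ n (leqnn n))] /=.
  rewrite sub0r normrN /F nuW/= => Wn; exists n%:R => //.
  have := le_lt_trans (ler_norm _) Wn; lra.
have contW : {within `[0, M], continuous W}.
  apply: parameterized_integral_continuous => //.
  exact: (integrableS measurableT).
have W0 : W 0 = 0 by rewrite /W /parameterized_integral set_itv1 Rintegral_set1.
have [|x] := @IVT _ W 0 M (1 - y) M0 contW.
  by rewrite W0 ge_min le_max WM subr_ge0 (ltW y1) orbT.
rewrite in_itv/= => /andP[x0 _] Wx; exists x; split => //.
by rewrite QW// Wx; ring.
Qed.

Lemma Qgamma_invK (y : K) : 0 < y < 1 ->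
  0 <= Qgamma_inv a y /\ Qgamma a (Qgamma_inv a y) = y.
Proof.
by move=> /Qgamma_surj ex; exact: (xgetPex 0 ex).
Qed.

End gamma_quantile.

(** * Independent normal coordinates and plane rotations *)

Section image_probability.
Context d1 d2 (T1 : measurableType d1) (T2 : measurableType d2) {K : realType}.

Definition image_probability (P : probability T1 K) (f : T1 -> T2)
    (mf : measurable_fun setT f) : probability T2 K :=
  distribution P (HB.pack f (isMeasurableFun.Build _ _ _ _ f mf) : {mfun T1 >-> T2}).

Lemma image_probabilityE (P : probability T1 K) f (mf : measurable_fun setT f) A :
  image_probability P mf A = P (f @^-1` A).
Proof. by []. Qed.

End image_probability.

Section joint_law.
Context d (T : measurableType d) {K : realType} (P : probability T K).
Local Notation G := (measurableTypeR K).
Local Open Scope ereal_scope.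

(** Dividing P by P E on E gives a measure on the plane that agrees with the
    product of m1 and m2 on rectangles, hence everywhere. The event E carries the
    conditions on the variables that are not transformed. *)
Lemma conditional_joint_law (E : set T) (U V : T -> G) (m1 m2 : probability G K) :
  measurable E -> measurable_fun setT U -> measurable_fun setT V ->
  (forall A B : set G, measurable A -> measurable B ->
    P [set w | [/\ E w, A (U w) & B (V w)]] = P E * (m1 A * m2 B)) ->
  forall C : set (G * G), measurable C ->
    P [set w | E w /\ C (U w, V w)] = P E * (m1 \x m2) C.
Proof.
move=> mE mU mV PUV C mC.
have mUV : measurable_fun setT (fun w => (U w, V w)) by exact: measurable_fun_pair.
have mUVC : measurable ((fun w => (U w, V w)) @^-1` C).
  by rewrite -[X in measurable X]setTI; exact: mUV.
have PE_fin : P E \is a fin_num by exact: fin_num_measure.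
have [PE0|PE0] := eqVneq (P E) 0.
  rewrite PE0 mul0e; apply/eqP; rewrite eq_le measure_ge0 andbT -PE0.
  by apply: le_measure; rewrite ?inE//; [exact: measurableI|move=> w []].
have fPE : (0 < fine (P E))%R by rewrite fine_gt0// lt0e PE0 measure_ge0/= ltey_eq PE_fin.
have k0 : (0 <= (fine (P E))^-1)%R by rewrite invr_ge0 ltW.
pose m' : {measure set (G * G) -> \bar K} :=
  mscale (NngNum k0) (image_measure (mrestr P mE) mUV).
have m'E D : m' D = ((fine (P E))^-1)%:E * P [set w | E w /\ D (U w, V w)].
  rewrite /m'/= /mscale/= /pushforward /mrestr; congr (_ * P _).
  by apply/seteqP; split => w /= [].
rewrite (@product_measure_unique _ _ _ _ _ m1 m2 m')//.
  by rewrite m'E muleA -{1}(fineK PE_fin) -EFinM divff ?gt_eqF// mul1e.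
move=> A B mA mB; rewrite m'E.
rewrite (_ : [set w | _] = [set w | [/\ E w, A (U w) & B (V w)]]); last first.
  by apply/seteqP; split => w /= => [[? []]|[]].
by rewrite PUV// muleA -{2}(fineK PE_fin) -EFinM mulVf ?gt_eqF// mul1e.
Qed.

End joint_law.

Section iid.
Context d (T : measurableType d) {K : realType} (P : probability T K).
Local Notation G := (measurableTypeR K).
Local Notation gauss := (normal_prob 0 1 : probability G K).
Local Open Scope ereal_scope.

(** Independence of the entries and their common standard normal law, in one
    product formula. *)
Definition iid_normal n (X : T -> 'rV[K]_n) :=
  (forall j, measurable_fun setT (fun w => X w ord0 j : G)) /\
  forall A : 'I_n -> set G, (forall j, measurable (A j)) ->
    P [set w | forall j, A j (X w ord0 j)] = \prod_j normal_prob 0 1 (A j).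

Section entries.
Variables (n : nat) (X : T -> 'rV[K]_n).
Hypothesis iidX : iid_normal X.
Let mX j : measurable_fun setT (fun w => X w ord0 j : G) := iidX.1 j.

Lemma measurable_entries (D : pred 'I_n) (A : 'I_n -> set G) :
  (forall j, measurable (A j)) ->
  measurable [set w | forall j, D j -> A j (X w ord0 j)].
Proof.
move=> mA.
rewrite (_ : [set w | _] =
    \big[setI/setT]_(j | D j) ((fun w => X w ord0 j) @^-1` A j)).
  apply: bigsetI_measurable => j _.
  by rewrite -[X in measurable X]setTI; exact: mX.
apply/seteqP; split => w /=.
  by move=> h; apply: (big_ind (fun Z : set T => Z w)) => // j Dj; exact: h.
by move=> + j Dj; rewrite (bigD1 j)//= => -[].
Qed.

Lemma iid_pair (i j : 'I_n) (A : 'I_n -> set G) (C : set (G * G)) : i != j ->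
  (forall l, measurable (A l)) -> measurable C ->
  P [set w | (forall l, (l != i) && (l != j) -> A l (X w ord0 l)) /\
             C (X w ord0 i, X w ord0 j)] =
  (\prod_(l | (l != i) && (l != j)) normal_prob 0 1 (A l)) * (gauss \x gauss) C.
Proof.
move=> ij mA mC.
have key (A1 A2 : set G) : measurable A1 -> measurable A2 ->
    P [set w | [/\ (forall l, (l != i) && (l != j) -> A l (X w ord0 l)),
                 A1 (X w ord0 i) & A2 (X w ord0 j)]] =
    (\prod_(l | (l != i) && (l != j)) normal_prob 0 1 (A l)) *
    (gauss A1 * gauss A2).
  move=> mA1 mA2.
  pose A' l := if l == i then A1 else if l == j then A2 else A l.
  have mA' l : measurable (A' l)
    by rewrite /A'; case: ifP => _; [exact: mA1|case: ifP => _; [exact: mA2|exact: mA]].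
  transitivity (P [set w | forall l, A' l (X w ord0 l)]).
    congr (P _); apply/seteqP; split => w /=.
      move=> [h1 h2 h3] l; rewrite /A'; case: eqVneq => [->//|li].
      by case: eqVneq => [->//|lj]; apply: h1; rewrite li.
    move=> h; split => [l /andP[li lj]||].
    - by have := h l; rewrite /A' (negbTE li) (negbTE lj).
    - by have := h i; rewrite /A' eqxx.
    - by have := h j; rewrite /A' eqxx eq_sym (negbTE ij).
  rewrite iidX.2// (bigD1 i)//= (bigD1 j)/=; last by rewrite eq_sym.
  rewrite /A' eqxx [j == i]eq_sym (negbTE ij) eqxx muleA muleC.
  by congr (_ * _); apply: eq_bigr => l /andP[/negbTE-> /negbTE->].
have PE : P [set w | forall l, (l != i) && (l != j) -> A l (X w ord0 l)] =
    \prod_(l | (l != i) && (l != j)) normal_prob 0 1 (A l).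
  have := key _ _ measurableT measurableT.
  rewrite !probability_setT !mule1 => <-; congr (P _).
  by apply/seteqP; split => w /= => [|[]].
rewrite -PE; apply: (@conditional_joint_law _ _ _ P _
  (fun w => X w ord0 i) (fun w => X w ord0 j)) => //.
- exact: (measurable_entries (fun l => (l != i) && (l != j)) mA).
- by move=> A1 A2 mA1 mA2; rewrite PE key.
Qed.

End entries.

Definition plane_rotation n (i j : 'I_n) (c s : K) (x : 'rV[K]_n) : 'rV[K]_n :=
  \row_l (if l == i then c * x ord0 i + s * x ord0 j
          else if l == j then c * x ord0 j - s * x ord0 i else x ord0 l)%R.

(** Only the pair of coordinates i and j changes; given the other coordinates its
    law is the product of two standard normal laws, which the rotation
    preserves. *)
Lemma iid_plane_rotation n (i j : 'I_n) (c s : K) (X : T -> 'rV[K]_n) :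
  i != j -> c != 0%R -> (c ^+ 2 + s ^+ 2 = 1)%R ->
  iid_normal X -> iid_normal (plane_rotation i j c s \o X).
Proof.
move=> ij c0 cs iidX; have mX := iidX.1; split.
  move=> l; rewrite (_ : (fun w => _) = fun w =>
    if l == i then c * X w ord0 i + s * X w ord0 j
    else if l == j then c * X w ord0 j - s * X w ord0 i else X w ord0 l)%R; last first.
    by apply/funext => w; rewrite /= mxE.
  case: (l == i); [|case: (l == j) => //].
    by apply: measurable_funD; apply: measurable_funM => //; exact: mX.
  by apply: measurable_funB; apply: measurable_funM => //; exact: mX.
move=> A mA.
pose C : set (G * G) :=
  [set z : G * G | A i (c * z.1 + s * z.2)%R /\ A j (c * z.2 - s * z.1)%R].
have mC : measurable C.
  apply: measurableI; rewrite -[X in measurable X]setTI.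
    apply: (_ : measurable_fun setT (fun z : G * G => c * z.1 + s * z.2 : G)%R) => //.
    by apply: measurable_funD; exact: measurable_funM.
  apply: (_ : measurable_fun setT (fun z : G * G => c * z.2 - s * z.1 : G)%R) => //.
  by apply: measurable_funB; exact: measurable_funM.
transitivity (P [set w | (forall l, (l != i) && (l != j) -> A l (X w ord0 l)) /\
             C (X w ord0 i, X w ord0 j)]).
  congr (P _); apply/seteqP; split => w /=.
    move=> h; split => [l /andP[li lj]|].
      by have := h l; rewrite mxE (negbTE li) (negbTE lj).
    split; first by have := h i; rewrite mxE eqxx.
    by have := h j; rewrite mxE eq_sym (negbTE ij) eqxx.
  move=> [h [hi hj]] l; rewrite mxE; case: eqVneq => [->//|li].
  by case: eqVneq => [->//|lj]; apply: h; rewrite li.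
rewrite iid_pair//.
transitivity ((\prod_(l | (l != i) && (l != j)) normal_prob 0 1 (A l)) *
  (normal_prob 0 1 (A i) * normal_prob 0 1 (A j))).
  by congr (_ * _); exact: normal_prob_rotation.
have ji : j != i by rewrite eq_sym.
by rewrite [RHS](bigD1 i)//= [X in _ = _ * X](bigD1 j)//= muleC -muleA.
Qed.

End iid.

(** * Sums of squares of independent normal coordinates *)

Section sum_of_squares.
Context d (T : measurableType d) {K : realType} (P : probability T K).
Local Notation G := (measurableTypeR K).
Local Notation gauss := (normal_prob 0 1 : probability G K).
Local Notation half_sqr := (fun y : K => y ^+ 2 / 2).
Variables (n : nat) (X : T -> 'rV[K]_n).
Hypothesis iidX : iid_normal P X.

Definition half_sqnorm_on (J : {set 'I_n}) (w : T) : K :=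
  \sum_(j in J) X w ord0 j ^+ 2 / 2.

Lemma measurable_half_sqnorm_on J : measurable_fun setT (half_sqnorm_on J : T -> G).
Proof.
rewrite (_ : half_sqnorm_on J =
    fun w => \sum_(j <- enum J) X w ord0 j ^+ 2 / 2); last first.
  by apply/funext => w; rewrite big_enum.
apply: (@measurable_sum _ _ K setT 'I_n (enum J) (fun j w => X w ord0 j ^+ 2 / 2)).
move=> j; apply: measurable_funM => //.
by apply: measurable_funX; exact: iidX.1.
Qed.

(** Induction on J, adding one coordinate at a time. The statement keeps the
    coordinates outside J in the event, which is the independence that the next
    step needs. *)
Lemma half_sqnorm_on_law (k : nat) (J : {set 'I_n}) : #|J| = k.+1 ->
  exists2 nu : probability G K, gamma_law (k.+1%:R / 2) nu &
    forall (C : set G) (A : 'I_n -> set G),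
      measurable C -> (forall l, measurable (A l)) ->
      P [set w | C (half_sqnorm_on J w) /\
                 forall l, l \notin J -> A l (X w ord0 l)] =
      (nu C * \prod_(l | l \notin J) gauss (A l))%E.
Proof.
pose nu1 : probability G K := image_probability gauss (@measurable_half_sqr K).
have nu1_gamma : gamma_law (1 / 2) nu1 by exact: gamma_law_half_sqr.
elim: k J => [|k IH] J cJ.
  have /cards1P[j ->] : #|J| == 1%N by rewrite cJ.
  exists nu1 => // C A mC mA.
  have mhC : measurable (half_sqr @^-1` C : set G).
    by rewrite -[X in measurable X]setTI; exact: measurable_half_sqr.
  pose A' l := if l == j then half_sqr @^-1` C else A l.
  have mA' l : measurable (A' l : set G) by rewrite /A'; case: (l == j).
  transitivity (P [set w | forall l, A' l (X w ord0 l)]).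
    congr (P _); apply/seteqP; split => w; rewrite /half_sqnorm_on /= big_set1.
      move=> [h1 h2] l; rewrite /A'; case: eqVneq => [->//|lj].
      by apply: h2; rewrite inE.
    move=> h; split; first by have := h j; rewrite /A' eqxx.
    by move=> l; rewrite inE => lj; have := h l; rewrite /A' (negbTE lj).
  rewrite iidX.2// (bigD1 j)//= {1}/A' eqxx; congr (_ * _)%E.
  apply: eq_big => [l|l lj]; first by rewrite inE.
  by rewrite /A' (negbTE lj).
have /card_gt0P[j jJ] : (0 < #|J|)%N by rewrite cJ.
pose J0 := J :\ j.
have cJ0 : #|J0| = k.+1 by have := cardsD1 j J; rewrite cJ jJ => -[].
have [nu0 nu0_gamma nu0E] := IH _ cJ0.
have madd : measurable_fun setT (fun z : G * G => z.1 + z.2 : G).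
  exact: measurable_funD.
exists (image_probability (nu0 \x nu1)%E madd).
  rewrite (_ : k.+2%:R / 2 = k.+1%:R / 2 + 1 / 2); last by rewrite -mulrDl natr1.
  exact: gamma_lawD.
move=> C A mC mA.
have notJ0 l : (l \notin J0) = (l == j) || (l \notin J).
  by rewrite !inE negb_and negbK.
pose E := [set w | forall l, l \notin J -> A l (X w ord0 l)].
have mE : measurable E by exact: (measurable_entries iidX).
have key (A1 A2 : set G) : measurable A1 -> measurable A2 ->
    P [set w | [/\ E w, A1 (half_sqnorm_on J0 w) & A2 (X w ord0 j ^+ 2 / 2)]] =
    ((\prod_(l | l \notin J) gauss (A l)) * (nu0 A1 * nu1 A2))%E.
  move=> mA1 mA2.
  have mhA2 : measurable (half_sqr @^-1` A2 : set G).
    by rewrite -[X in measurable X]setTI; exact: measurable_half_sqr.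
  pose A' l := if l == j then half_sqr @^-1` A2 else A l.
  have mA' l : measurable (A' l : set G) by rewrite /A'; case: (l == j).
  transitivity (P [set w | A1 (half_sqnorm_on J0 w) /\
                 forall l, l \notin J0 -> A' l (X w ord0 l)]).
    congr (P _); apply/seteqP; split => w /=.
      move=> [h1 h2 h3]; split => // l; rewrite notJ0 /A'.
      by case: eqVneq => [->//|lj] /=; exact: h1.
    move=> [h1 h2]; split => //.
      move=> l lJ; have := h2 l; rewrite notJ0 lJ orbT /A'.
      by case: eqVneq => [lj|_]; [rewrite -lj (negbTE lJ) in jJ|exact].
    by have := h2 j; rewrite notJ0 eqxx /A' eqxx; exact.
  rewrite nu0E//.
  have -> : (\prod_(l | l \notin J0) gauss (A' l) =
      nu1 A2 * \prod_(l | l \notin J) gauss (A l))%E.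
    rewrite (bigD1 j)/=; last by rewrite notJ0 eqxx.
    rewrite {1}/A' eqxx; congr (_ * _)%E.
    apply: eq_big => [l|l /andP[_ lj]]; last by rewrite /A' (negbTE lj).
    rewrite notJ0; case: eqVneq => [->|_] /=; first by rewrite jJ.
    by rewrite andbT.
  by rewrite muleA muleC.
have PE : P E = (\prod_(l | l \notin J) gauss (A l))%E.
  have := key _ _ measurableT measurableT.
  rewrite (probability_setT nu0) (probability_setT nu1) !mule1 => <-; congr (P _).
  by apply/seteqP; split => w /= => [|[]].
rewrite muleC -PE (image_probabilityE (nu0 \x nu1)%E madd).
rewrite -(@conditional_joint_law _ _ _ P E (half_sqnorm_on J0)
  (fun w => X w ord0 j ^+ 2 / 2))//; first last.
- by rewrite -[X in measurable X]setTI; exact: madd.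
- by move=> A1 A2 mA1 mA2; rewrite PE key.
- by apply: measurable_funM => //; apply: measurable_funX; exact: iidX.1.
- exact: measurable_half_sqnorm_on.
have SJ w : half_sqnorm_on J w = half_sqnorm_on J0 w + X w ord0 j ^+ 2 / 2.
  by rewrite /half_sqnorm_on (big_setD1 j jJ)/= addrC.
by congr (P _); apply/seteqP; split => w /=; rewrite SJ => -[].
Qed.

Lemma half_sqnorm_on_tail (J : {set 'I_n}) (q : K) : (0 < #|J|)%N -> 0 <= q ->
  P [set w | q < half_sqnorm_on J w] = (Qgamma (#|J|%:R / 2) q)%:E.
Proof.
case cJ : #|J| => [//|k] _ q0; have [nu nu_gamma nuE] := half_sqnorm_on_law cJ.
rewrite -(gamma_law_tail nu_gamma q0).
have := nuE `]q, +oo[%classic (fun=> setT) (measurable_itv _) (fun=> measurableT).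
rewrite big1 => [|l _]; last exact: (probability_setT gauss).
rewrite mule1 => <-; congr (P _); apply/seteqP; split => w /=; rewrite in_itv/= andbT.
  by [].
by case.
Qed.

End sum_of_squares.

(** * Compression to few coordinates by rotations *)

Section sqnorm.
Context {K : realType}.

Definition sqnorm n (x : 'rV[K]_n) : K := \sum_j x ord0 j ^+ 2.

Lemma sqnorm_ge0 n (x : 'rV[K]_n) : 0 <= sqnorm x.
Proof. by apply: sumr_ge0 => j _; rewrite sqr_ge0. Qed.

Lemma sqnorm0 n : sqnorm (0 : 'rV[K]_n) = 0.
Proof. by rewrite /sqnorm big1// => j _; rewrite mxE expr0n. Qed.

Lemma sqnorm_eq0 n (x : 'rV[K]_n) : sqnorm x = 0 -> x = 0.
Proof.
move=> x0; apply/rowP => j; rewrite mxE; apply/eqP; rewrite -sqrf_eq0.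
by rewrite (psumr_eq0P (fun i _ => sqr_ge0 (x ord0 i)) x0).
Qed.

Lemma sqnorm_gt0 n (x : 'rV[K]_n) : x != 0 -> 0 < sqnorm x.
Proof.
move=> x0; rewrite lt_neqAle sqnorm_ge0 andbT eq_sym.
by apply: contra x0 => /eqP/sqnorm_eq0 ->.
Qed.

Lemma sqnormZ n (a : K) (x : 'rV[K]_n) : sqnorm (a *: x) = a ^+ 2 * sqnorm x.
Proof. by rewrite /sqnorm mulr_sumr; apply: eq_bigr => j _; rewrite mxE exprMn. Qed.

Lemma sqnorm_rotation n (i j : 'I_n) (c s : K) (x : 'rV[K]_n) :
  i != j -> c ^+ 2 + s ^+ 2 = 1 ->
  sqnorm (plane_rotation i j c s x) = sqnorm x.
Proof.
move=> ij cs; have ji : j != i by rewrite eq_sym.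
rewrite /sqnorm (bigD1 i)//= (bigD1 j)//= addrA.
rewrite [RHS](bigD1 i)//= (bigD1 (P := fun l => l != i) j)//= addrA.
congr (_ + _); last first.
  by apply: eq_bigr => l /andP[/negbTE li /negbTE lj]; rewrite mxE li lj.
rewrite !mxE !eqxx (negbTE ji).
transitivity ((c ^+ 2 + s ^+ 2) * (x ord0 i ^+ 2 + x ord0 j ^+ 2)); first by ring.
by rewrite cs mul1r.
Qed.

End sqnorm.

Section plane_rotation_linear.
Context {K : realType} (n : nat) (i j : 'I_n) (c s : K).

Lemma plane_rotation_is_linear : linear (@plane_rotation K n i j c s).
Proof.
move=> a x y; apply/rowP => l; rewrite !mxE.
by case: ifP => _; [ring|case: ifP => _; [ring|]].
Qed.

HB.instance Definition _ := GRing.isLinear.Build K 'rV[K]_n 'rV[K]_n _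
  (@plane_rotation K n i j c s) plane_rotation_is_linear.

Definition rotation_mx : 'M[K]_n := lin1_mx (@plane_rotation K n i j c s).

Lemma mul_rotation_mx (x : 'rV[K]_n) : x *m rotation_mx = plane_rotation i j c s x.
Proof. exact: mul_rV_lin1. Qed.

End plane_rotation_linear.

Section gaussian_isometries.
Context d (T : measurableType d) {K : realType} (P : probability T K).

(** Every orthogonal matrix is one, but only products of plane rotations are
    used, and for these both properties follow by composition. *)
Definition gaussian_isometry n (V : 'M[K]_n) :=
  (forall x : 'rV_n, sqnorm (x *m V) = sqnorm x) /\
  forall X : T -> 'rV[K]_n, iid_normal P X -> iid_normal P (fun w => X w *m V).

Lemma gaussian_isometry1 n : gaussian_isometry (1%:M : 'M[K]_n).
Proof.
split=> [x|X iidX]; first by rewrite mulmx1.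
by rewrite (_ : (fun w => _) = X)//; apply/funext => w; rewrite mulmx1.
Qed.

Lemma gaussian_isometryM n (V1 V2 : 'M[K]_n) :
  gaussian_isometry V1 -> gaussian_isometry V2 -> gaussian_isometry (V1 *m V2).
Proof.
move=> [i1 g1] [i2 g2]; split=> [x|X iidX]; first by rewrite mulmxA i2 i1.
have := g2 _ (g1 _ iidX).
by rewrite (_ : (fun w => X w *m V1 *m V2) = fun w => X w *m (V1 *m V2))//;
  apply/funext => w; rewrite mulmxA.
Qed.

Lemma gaussian_isometry_unit n (V : 'M[K]_n) : gaussian_isometry V -> V \in unitmx.
Proof.
move=> [isoV _]; rewrite -row_free_unit -kermx_eq0; apply/rowV0P => v.
by move=> /sub_kermxP vV; apply: sqnorm_eq0; rewrite -isoV vV sqnorm0.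
Qed.

Lemma gaussian_isometry_rotation n (i j : 'I_n) (c s : K) :
  i != j -> c != 0 -> c ^+ 2 + s ^+ 2 = 1 ->
  gaussian_isometry (rotation_mx i j c s).
Proof.
move=> ij c0 cs; split=> [x|X iidX].
  by rewrite mul_rotation_mx sqnorm_rotation.
have := iid_plane_rotation ij c0 cs iidX.
by rewrite (_ : _ \o X = fun w => X w *m rotation_mx i j c s)//;
  apply/funext => w; rewrite mul_rotation_mx.
Qed.

Definition fixes_off n (J : {set 'I_n}) (V : 'M[K]_n) :=
  forall l, l \notin J -> delta_mx ord0 l *m V = delta_mx ord0 l :> 'rV_n.

(** Rotating the plane of two nonzero coordinates v_i and v_j moves their whole
    length to v_i, so the support of v shrinks until a single coordinate is
    left. *)
Lemma rotate_to_axis n (J : {set 'I_n}) (v : 'rV[K]_n) : v != 0 ->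
  (forall l, l \notin J -> v ord0 l = 0) ->
  exists V j (rho : K), [/\ gaussian_isometry V, fixes_off J V, j \in J,
    rho != 0 & v *m V = rho *: delta_mx ord0 j].
Proof.
pose supp (v : 'rV[K]_n) := [set l | v ord0 l != 0]%SET.
have [m] := ubnP #|supp v|; elim: m v => // m IH v cv v0 vJ.
have /rV0Pn[i vi] := v0.
have iJ : i \in J by apply: contraT => /vJ vi0; rewrite vi0 eqxx in vi.
have [j /andP[ji vj]|vsupp] := pickP (fun j => (j != i) && (v ord0 j != 0)).
  have ij : i != j by rewrite eq_sym.
  have jJ : j \in J by apply: contraT => /vJ vj0; rewrite vj0 eqxx in vj.
  pose r := Num.sqrt (v ord0 i ^+ 2 + v ord0 j ^+ 2).
  have r2 : r ^+ 2 = v ord0 i ^+ 2 + v ord0 j ^+ 2.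
    by rewrite sqr_sqrtr// addr_ge0 ?sqr_ge0.
  have r0 : r != 0.
    rewrite -sqrf_eq0 r2 paddr_eq0 ?sqr_ge0// !sqrf_eq0 negb_and.
    by rewrite vi.
  (* With these values c * v_j - s * v_i vanishes. *)
  pose c := v ord0 i / r; pose s := v ord0 j / r.
  have c0 : c != 0 by rewrite mulf_neq0 ?invr_eq0.
  have cs : c ^+ 2 + s ^+ 2 = 1.
    by rewrite /c /s !expr_div_n -mulrDl -r2 divff// sqrf_eq0.
  pose V1 := rotation_mx i j c s.
  have gV1 : gaussian_isometry V1 by exact: gaussian_isometry_rotation.
  have fV1 : fixes_off J V1.
    move=> l lJ; rewrite mul_rotation_mx; apply/rowP => p; rewrite !mxE eqxx/=.
    have il : i == l = false by apply/negbTE; apply: contraNneq lJ => <-.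
    have jl : j == l = false by apply/negbTE; apply: contraNneq lJ => <-.
    rewrite il jl; case: eqVneq => [->|pi]; first by rewrite il !mulr0 addr0.
    by case: eqVneq => [->|//]; rewrite jl !mulr0 subr0.
  pose v' := v *m V1.
  have v'E l : v' ord0 l = if l == i then c * v ord0 i + s * v ord0 j
      else if l == j then 0 else v ord0 l.
    rewrite /v' mul_rotation_mx mxE; case: eqP => // _; case: eqP => // _.
    by rewrite /c /s; field.
  have v'0 : v' != 0.
    apply: contra v0 => /eqP v'0; apply/eqP/sqnorm_eq0.
    by rewrite -gV1.1 -/v' v'0 sqnorm0.
  have v'J l : l \notin J -> v' ord0 l = 0.
    move=> lJ; rewrite v'E; case: eqVneq lJ => [->|_ lJ]; first by rewrite iJ.
    by case: eqVneq => // _; exact: vJ.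
  have cv' : (#|supp v'| < m)%N.
    rewrite -ltnS; apply: leq_trans cv; rewrite ltnS; apply: proper_card.
    apply/properP; split; last first.
      by exists j; rewrite /supp !inE ?vj// v'E (negbTE ji) eqxx eqxx.
    apply/fintype.subsetP => l; rewrite /supp !inE v'E; case: (eqVneq l i) => [->//|_].
    by case: (eqVneq l j) => //; rewrite eqxx.
  have [V2 [p [rho [gV2 fV2 pJ rho0 vV]]]] := IH v' cv' v'0 v'J.
  exists (V1 *m V2), p, rho; split => //.
  - exact: gaussian_isometryM.
  - by move=> l lJ; rewrite mulmxA fV1// fV2.
  - by rewrite mulmxA.
exists 1%:M, i, (v ord0 i); split => //.
- exact: gaussian_isometry1.
- by move=> l _; rewrite mulmx1.
- rewrite mulmx1; apply/rowP => l; rewrite !mxE eqxx/=.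
  have := vsupp l; case: eqVneq => [->|li] /=; first by rewrite mulr1.
  by move=> /negbFE/eqP ->; rewrite mulr0.
Qed.

(** More than k rows of length k are linearly dependent. *)
Lemma left_null_vector n k (J : {set 'I_n}) (A : 'M[K]_(n, k)) : (k < #|J|)%N ->
  exists v : 'rV[K]_n, [/\ v != 0, forall l, l \notin J -> v ord0 l = 0 & v *m A = 0].
Proof.
move=> kJ; pose f (a : 'I_#|J|) : 'I_n := enum_val a.
pose S : 'M[K]_(#|J|, n) := rowsub f 1%:M.
have : ~~ row_free (S *m A).
  by rewrite /row_free neq_ltn (leq_ltn_trans (rank_leq_col _) kJ).
rewrite -kermx_eq0 => /rowV0Pn[u /sub_kermxP uSA u0].
have SE a l : S a l = (f a == l)%:R by rewrite !mxE.
have uSf a : (u *m S) ord0 (f a) = u ord0 a.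
  rewrite mxE (bigD1 a)//= SE eqxx mulr1 big1 ?addr0// => b ba.
  by rewrite SE (inj_eq enum_val_inj) (negbTE ba) mulr0.
exists (u *m S); split.
- apply: contra u0 => /eqP uS0; apply/eqP/rowP => a.
  by rewrite -uSf uS0 !mxE.
- move=> l lJ; rewrite mxE big1// => a _; rewrite SE.
  by case: eqVneq => [fal|_]; [rewrite -fal enum_valP in lJ|rewrite mulr0].
- by rewrite -mulmxA.
Qed.

(** A dependency v between the rows in J is rotated to a multiple of a coordinate
    vector e_j. From v A = 0 it follows that e_j (V^-1 A) = 0, so row j of V^-1 A
    vanishes; the rows outside J remain zero since V fixes their coordinate
    vectors. *)
Lemma gaussian_row_compression n k (A : 'M[K]_(n, k)) : (k <= n)%N ->
  exists V (J : {set 'I_n}), [/\ gaussian_isometry V, #|J| = k &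
    forall l, l \notin J -> row l (invmx V *m A) = 0].
Proof.
move=> kn.
suff main m (J : {set 'I_n}) (A' : 'M[K]_(n, k)) : #|J| = (m + k)%N ->
    (forall l, l \notin J -> row l A' = 0) ->
    exists V (J' : {set 'I_n}), [/\ gaussian_isometry V, #|J'| = k &
    forall l, l \notin J' -> row l (invmx V *m A') = 0].
  apply: (main (n - k)%N [set: 'I_n]%SET); first by rewrite cardsT card_ord subnK.
  by move=> l; rewrite inE.
elim: m J A' => [|m IH] J A' cJ A'J.
  exists 1%:M, J; split => //; first exact: gaussian_isometry1.
  by move=> l lJ; rewrite invmx1 mul1mx A'J.
have kJ : (k < #|J|)%N by rewrite cJ addSn ltnS leq_addl.
have [v [v0 vJ vA]] := left_null_vector A' kJ.
have [V1 [j [rho [gV1 fV1 jJ rho0 vV1]]]] := rotate_to_axis v0 vJ.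
have uV1 := gaussian_isometry_unit gV1.
have cJ1 : #|J :\ j| = (m + k)%N by have := cardsD1 j J; rewrite cJ jJ addSn => -[].
have [|V2 [J' [gV2 cJ' VA]]] := IH (J :\ j) (invmx V1 *m A') cJ1.
  move=> l; rewrite rowE mulmxA !inE negb_and negbK => /orP[/eqP ->|lJ].
    apply: (scalerI rho0); rewrite scaler0 !scalemxAl -vV1.
    by rewrite mulmxK.
  by rewrite -(fV1 _ lJ) mulmxK// -rowE A'J.
exists (V1 *m V2), J'; split => //; first exact: gaussian_isometryM.
have uV2 := gaussian_isometry_unit gV2.
have uV12 : V1 *m V2 \in unitmx by rewrite unitmx_mul uV1.
have -> : invmx (V1 *m V2) = invmx V2 *m invmx V1.
  apply: (can_inj (mulmxK uV12)); rewrite mulVmx// mulmxA.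
  by rewrite mulmxKV// mulVmx.
by move=> l /VA; rewrite mulmxA.
Qed.

End gaussian_isometries.

(** * Rayleigh quotients *)

Section rayleigh.
Context {K : realType}.

Definition quad n (M : 'M[K]_n) (x : 'rV[K]_n) : K := (x *m M *m x^T) ord0 ord0.

Lemma quadE n (M : 'M[K]_n) x :
  quad M x = \sum_j (\sum_i x ord0 i * M i j) * x ord0 j.
Proof. by rewrite /quad mxE; apply: eq_bigr => j _; rewrite !mxE. Qed.

Lemma mul_tr_sqnorm n (x : 'rV[K]_n) : (x *m x^T) ord0 ord0 = sqnorm x.
Proof. by rewrite mxE; apply: eq_bigr => j _; rewrite mxE expr2. Qed.

Lemma quad_scalar n (a : K) (x : 'rV[K]_n) : quad a%:M x = a * sqnorm x.
Proof.
by rewrite /quad mul_mx_scalar -scalemxAl mxE mul_tr_sqnorm.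
Qed.

Lemma quadB n (M N : 'M[K]_n) x : quad (M - N) x = quad M x - quad N x.
Proof. by rewrite /quad mulmxBr mulmxBl !mxE. Qed.

Lemma quadN n (M : 'M[K]_n) x : quad (- M) x = - quad M x.
Proof. by rewrite /quad mulmxN mulNmx mxE. Qed.

Lemma quadZ n (M : 'M[K]_n) (a : K) x : quad M (a *: x) = a ^+ 2 * quad M x.
Proof.
by rewrite /quad linearZ/= -scalemxAr -!scalemxAl scalerA mxE expr2.
Qed.

Lemma continuous_sum (T : topologicalType) (I : Type) (r : seq I) (f : I -> T -> K) :
  (forall i, continuous (f i)) -> continuous (fun x => \sum_(i <- r) f i x).
Proof.
move=> cf; elim: r => [|i r IH] x.
  rewrite (_ : (fun x => _) = cst 0); first exact: cst_continuous.
  by apply/funext => y; rewrite big_nil.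
rewrite (_ : (fun x => _) = fun x => f i x + \sum_(j <- r) f j x).
  by apply: cvgD; [exact: cf|exact: IH].
by apply/funext => y; rewrite big_cons.
Qed.

(** The abstract space T in the proof stands for the space of rows, so that the
    form is handled as a polynomial in continuous coordinate functions. *)
Lemma quad_continuous n (M : 'M[K]_n) : continuous (quad M : 'rV[K]_n -> K).
Proof.
have cquad (T : topologicalType) (c : 'I_n -> T -> K) : (forall j, continuous (c j)) ->
    continuous (fun x => \sum_j (\sum_i c i x * M i j) * c j x).
  move=> cc; apply: continuous_sum => j x; apply: cvgM; last exact: cc.
  by apply: continuous_sum => i y; apply: cvgM; [exact: cc|exact: cvg_cst].
rewrite (_ : quad M = fun x => \sum_j (\sum_i x ord0 i * M i j) * x ord0 j).
  pose c (j : 'I_n) (x : 'rV[K]_n) : K := x ord0 j.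
  have cc j : continuous (c j) by exact: coord_continuous.
  exact: (cquad 'rV[K]_n c cc).
by apply/funext => x; exact: quadE.
Qed.

(** With y = x N and quad N x = 0, the value of the form at x + t y is
    2 t |y|^2 + t^2 (quad N y), which is negative for small negative t unless
    y = 0. *)
Lemma psd_quad0 n (N : 'M[K]_n) (x : 'rV[K]_n) : N^T = N ->
  (forall y, 0 <= quad N y) -> quad N x = 0 -> x *m N = 0.
Proof.
move=> Nsym N0 qx; pose y := x *m N.
have expand t : quad N (x + t *: y) = quad N x + 2 * t * sqnorm y + t ^+ 2 * quad N y.
  rewrite -quadZ; set z := t *: y.
  rewrite /quad linearD/= mulmxDl mulmxDr !mulmxDl.
  rewrite [LHS]mxE [X in X + _]mxE [X in _ + X]mxE.
  have -> : (x *m N *m z^T) ord0 ord0 = t * sqnorm y.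
    by rewrite -/y /z linearZ/= -scalemxAr mxE mul_tr_sqnorm.
  have -> : (z *m N *m x^T) ord0 ord0 = t * sqnorm y.
    have -> : z *m N *m x^T = (x *m N *m z^T)^T.
      by rewrite !trmx_mul trmxK Nsym mulmxA.
    by rewrite mxE -/y /z linearZ/= -scalemxAr mxE mul_tr_sqnorm.
  by ring.
apply: sqnorm_eq0; rewrite -/y.
set g := quad N y; have g0 : 0 <= g by exact: N0.
have s0 := sqnorm_ge0 y; set s := sqnorm y in expand s0 *.
(* The step is t |y|^2 with t = - 1 / (g + 1): then 2 + t g = 1 - t > 0, so that
   the increment t (1 - t) |y|^4 is negative as soon as y is nonzero. *)
pose t : K := - (g + 1)^-1.
have tg : t * (g + 1) = -1 by rewrite /t mulNr mulVf// gt_eqF// ltr_wpDl.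
have := N0 (x + (t * s) *: y); rewrite expand qx add0r -/g.
have -> : 2 * (t * s) * s + (t * s) ^+ 2 * g = t * s ^+ 2 * (2 + t * g) by ring.
have -> : t * g = -1 - t by rewrite -tg; ring.
have t0 : t < 0 by rewrite oppr_lt0 invr_gt0 ltr_wpDl.
have -> : t * s ^+ 2 * (2 + (-1 - t)) = - ((- t * (1 - t)) * s ^+ 2) by ring.
rewrite oppr_ge0 pmulr_rle0; last by rewrite mulr_gt0//; lra.
by move=> s20; apply/eqP; rewrite -sqrf_eq0 eq_le s20 sqr_ge0.
Qed.

(** The form attains a maximum a at some x0 on the compact unit sphere. Then
    a - M is positive semidefinite and vanishes at x0, so that x0 is an
    eigenvector by psd_quad0. *)
Lemma quad_rayleigh n (M : 'M[K]_n) : (0 < n)%N -> M^T = M ->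
  exists2 a, eigenvalue M a & forall x, quad M x <= a * sqnorm x.
Proof.
move=> n0 Msym.
pose S := [set x : 'rV[K]_n | quad 1%:M x = 1].
have SE x : S x <-> sqnorm x = 1 by rewrite /S/= quad_scalar mul1r.
have S0 : S !=set0.
  exists (delta_mx ord0 (Ordinal n0)); apply/SE; rewrite /sqnorm.
  rewrite (bigD1 (Ordinal n0))//= big1 => [|j jn].
    by rewrite mxE !eqxx expr1n addr0.
  by rewrite mxE eqxx (negbTE jn) expr0n.
have cS : compact S.
  apply: bounded_closed_compact.
    exists 1; split; first exact: num_real.
    move=> m m1 x /SE x1; apply: le_trans (ltW m1).
    rewrite [leLHS]/Num.Def.normr/= mx_normrE; apply/bigmax_leP; split => // -[i j] _ /=.
    rewrite (ord1 i) -sqrtr_sqr -[leRHS]sqrtr1 ler_wsqrtr// -x1 /sqnorm.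
    by rewrite (bigD1 j)//= lerDl sumr_ge0// => l _; exact: sqr_ge0.
  rewrite (_ : S = quad 1%:M @^-1` [set 1])//.
  by apply: closed_comp => [x _|]; [exact: quad_continuous|exact: closed_eq].
have [x0 /set_mem/SE x01 x0max] : exists2 c, c \in S & forall t, t \in S -> quad M t <= quad M c.
  apply: EVT_max_rV => //; apply: continuous_subspaceT; exact: quad_continuous.
pose a := quad M x0.
have ray x : quad M x <= a * sqnorm x.
  have [->|xn0] := eqVneq x 0.
    by rewrite sqnorm0 mulr0 /quad trmx0 mulmx0 mxE.
  have sx := sqnorm_gt0 xn0.
  pose r := (Num.sqrt (sqnorm x))^-1.
  have r2 : r ^+ 2 = (sqnorm x)^-1 by rewrite exprVn sqr_sqrtr// ltW.
  have /x0max : r *: x \in S.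
    by apply/mem_set/SE; rewrite sqnormZ r2 mulVf// gt_eqF.
  by rewrite quadZ r2 mulrC ler_pdivrMr.
exists a => //; apply/eigenvalueP; exists x0.
  have : x0 *m (a%:M - M) = 0.
    apply: psd_quad0.
    - by rewrite linearB/= tr_scalar_mx Msym.
    - by move=> y; rewrite quadB quad_scalar subr_ge0.
    - by rewrite quadB quad_scalar x01 mulr1 subrr.
  by rewrite mulmxBr mul_mx_scalar => /eqP; rewrite subr_eq0 => /eqP ->.
apply/eqP => x00; move: x01; rewrite x00 sqnorm0 => /eqP.
by rewrite eq_sym oner_eq0.
Qed.

(** The value a of quad_rayleigh bounds all the eigenvalues, so their supremum is
    not a default value. *)
Lemma le_lambda_max n (M : 'M[K]_n) (x : 'rV[K]_n) : (0 < n)%N -> M^T = M ->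
  quad M x <= lambda_max M * sqnorm x.
Proof.
move=> n0 Msym; have [a eva ray] := quad_rayleigh n0 Msym.
apply: (le_trans (ray x)); apply: ler_wpM2r; first exact: sqnorm_ge0.
apply: ub_le_sup => //; exists a => b /= /eigenvalueP[v vb v0].
have sv := sqnorm_gt0 v0.
rewrite -(ler_pM2r sv); apply: le_trans (ray v).
by rewrite /quad vb -mul_mx_scalar -[leRHS]/(quad b%:M v) quad_scalar.
Qed.

Lemma quad_coercive n (M : 'M[K]_n) : (0 < n)%N -> M^T = M ->
  (forall x, x != 0 -> 0 < quad M x) ->
  exists2 b, 0 < b & forall x, b * sqnorm x <= quad M x.
Proof.
move=> n0 Msym pM.
have [|a /eigenvalueP[v va v0] ray] := @quad_rayleigh _ (- M) n0.
  by rewrite linearN/= Msym.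
exists (- a); last by move=> x; have := ray x; rewrite quadN mulNr lerNl.
have sv := sqnorm_gt0 v0.
rewrite oppr_gt0 -(pmulr_llt0 _ sv) -quad_scalar /quad mul_mx_scalar -va.
by rewrite -/(quad (- M) v) quadN oppr_lt0 pM.
Qed.

End rayleigh.

(** * Norms in coordinates *)

Section hilbert_bounds.
Context {K : realType} {S R : vectType K}.
Variables (ipS : {dot S for idfun}) (ipR : {dot R for idfun}).
Variable B : (\dim {:S}).-tuple S.
Hypothesis hB : basis_of fullv B.
Variable O : 'Hom(S, R).
Local Notation N := (\dim {:S}).

Lemma dot_sym (V : vectType K) (ip : {dot V for idfun}) (u v : V) : ip u v = ip v u.
Proof. by have := hermC ip u v; rewrite /= expr0 mul1r. Qed.

Lemma dot_ge0 (V : vectType K) (ip : {dot V for idfun}) (v : V) : 0 <= ip v v.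
Proof.
have [->|v0] := eqVneq v 0; last exact/ltW/neq0_dnorm_gt0.
by rewrite linear0.
Qed.

Lemma hnorm_ge0 (V : vectType K) (ip : {dot V for idfun}) (v : V) : 0 <= hnorm ip v.
Proof. exact: sqrtr_ge0. Qed.

Definition image_gram : 'M[K]_N := \matrix_(i, j) ipR (O B`_i) (O B`_j).

Lemma image_gram_sym : image_gram^T = image_gram.
Proof. by apply/matrixP => i j; rewrite !mxE dot_sym. Qed.

Lemma gram_sym : (gram ipS B)^T = gram ipS B.
Proof. by apply/matrixP => i j; rewrite !mxE dot_sym. Qed.

Lemma dot_vecof (x : 'rV_N) : ipS (passmx.vecof B x) (passmx.vecof B x) = quad (gram ipS B) x.
Proof. by rewrite (gramE _ _ _ hB) passmx.vecofK. Qed.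

Lemma dot_image_vecof (x : 'rV_N) :
  ipR (O (passmx.vecof B x)) (O (passmx.vecof B x)) = quad image_gram x.
Proof.
have -> : O (passmx.vecof B x) = \sum_i x 0 i *: O B`_i.
  by rewrite /passmx.vecof linear_sum; apply: eq_bigr => i _; rewrite linearZ.
rewrite quadE linear_sumr.
apply: eq_bigr => j _; rewrite linear_sumlz /= mulr_suml; apply: eq_bigr => i _.
by rewrite linearZl_LR linearZr_LR /= !mxE mulrA mulrAC.
Qed.

Hypothesis N0 : (0 < N)%N.

(** The supremum that defines the operator norm is over a bounded set: in
    coordinates |O v|^2 is at most |g| |x|^2 and |v|^2 at least b |x|^2 with
    b > 0. *)
Lemma hnorm_image_le (v : S) : hnorm ipR (O v) <= opnorm ipS ipR O * hnorm ipS v.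
Proof.
have [->|v0] := eqVneq v 0.
  by rewrite linear0 /hnorm !linear0 sqrtr0 mulr0.
have hS (u : S) : u != 0 -> 0 < hnorm ipS u.
  by move=> u0; rewrite sqrtr_gt0 neq0_dnorm_gt0.
have [b b0 coer] : exists2 b, 0 < b & forall x, b * sqnorm x <= quad (gram ipS B) x.
  apply: quad_coercive => //; first exact: gram_sym.
  move=> x x0; rewrite -dot_vecof; apply: neq0_dnorm_gt0.
  by rewrite passmx.vecof_eq0.
have [g _ ray] := quad_rayleigh N0 image_gram_sym.
rewrite -ler_pdivrMr ?hS//; apply: ub_le_sup; last by exists v.
exists (Num.sqrt (`|g| / b)) => _ [u /= u0 <-].
rewrite ler_pdivrMr ?hS// /hnorm -sqrtrM; last by rewrite divr_ge0// ltW.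
apply: ler_wsqrtr.
rewrite -(passmx.rVofK hB u) dot_image_vecof dot_vecof; set x := passmx.rVof B u.
rewrite mulrAC ler_pdivlMr//.
apply: (@le_trans _ _ (`|g| * sqnorm x * b)).
  rewrite ler_wpM2r ?(ltW b0)//; apply: (le_trans (ray x)).
  by rewrite ler_wpM2r ?sqnorm_ge0 ?ler_norm.
by rewrite -mulrA ler_wpM2l// mulrC coer.
Qed.

Lemma opnorm_ge0 : 0 <= opnorm ipS ipR O.
Proof.
pose v := passmx.vecof B (delta_mx ord0 (Ordinal N0)).
have v0 : v != 0.
  rewrite passmx.vecof_eq0//; apply/eqP => /rowP/(_ (Ordinal N0)).
  by rewrite !mxE !eqxx => /eqP; rewrite oner_eq0.
have hv : 0 < hnorm ipS v by rewrite sqrtr_gt0 neq0_dnorm_gt0.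
rewrite -(pmulr_lge0 _ hv); apply: le_trans (hnorm_image_le v).
exact: hnorm_ge0.
Qed.

Lemma hnorm_image_vecof_le (x : 'rV_N) : hnorm ipR (O (passmx.vecof B x)) <=
  opnorm ipS ipR O * Num.sqrt (lambda_max (gram ipS B) * sqnorm x).
Proof.
apply: (le_trans (hnorm_image_le _)); apply: ler_wpM2l; first exact: opnorm_ge0.
rewrite ler_wsqrtr// dot_vecof.
by apply: le_lambda_max => //; exact: gram_sym.
Qed.

Lemma lambda_max_gram_ge0 : 0 <= lambda_max (gram ipS B).
Proof.
pose x : 'rV[K]_N := const_mx 1.
have x0 : 0 < sqnorm x.
  rewrite /sqnorm; under eq_bigr do rewrite mxE expr1n.
  by rewrite sumr_const card_ord ltr0n.
rewrite -(pmulr_lge0 _ x0); apply: le_trans (le_lambda_max x N0 gram_sym).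
by rewrite -dot_vecof dot_ge0.
Qed.

(** The sign of e = erf^-1(..) is immaterial, since c_eff contains |e^-1| while
    the effectivity contains e^-1; and when lambda_min or the operator norm is
    not positive, the effectivity is 0. *)
Lemma effectivity_le (nt : nat) (eps q : K) (r : 'I_nt -> N.-tuple K) :
  0 <= q ->
  (forall i, hnorm ipR (O (Dinv B (r i))) <=
    opnorm ipS ipR O * Num.sqrt (lambda_max (gram ipS B) * (2 * q))) ->
  q = Qgamma_inv ((\dim (limg O))%:R / 2) (eps / nt%:R) ->
  effectivity ipS ipR B O eps r <= c_eff ipS B O nt eps.
Proof.
move=> q0 hr qE; rewrite /effectivity /Delta /c_est /c_eff -qE.
set L := lambda_max _ in hr *; set l := lambda_min _; set e := erfinv _.
set opn := opnorm _ _ _ in hr *; set m := \big[_/_]_(_ < _) _.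
have opn0 : 0 <= opn by exact: opnorm_ge0.
have m0 : 0 <= m by exact: bigmax_ge_id.
have mL : m <= opn * Num.sqrt (L * (2 * q)).
  apply/bigmax_leP; split=> [|i _]; last exact: hr.
  by rewrite mulr_ge0// sqrtr_ge0.
have [l0|l0] := leP l 0.
  rewrite (@ler0_sqrtr _ (2 * l)) ?mul0r ?invr0 ?mul0r ?sqrtr_ge0//.
  by rewrite pmulr_rle0.
have [opnz|opnz] := eqVneq opn 0; first by rewrite opnz invr0 mulr0 sqrtr_ge0.
have opnp : 0 < opn by rewrite lt_neqAle eq_sym opnz.
have s2l : 0 < Num.sqrt (2 * l) by rewrite sqrtr_gt0 mulr_gt0.
have -> : q * (L / l) * e ^- 2 = e^-1 ^+ 2 * ((2 * l)^-1 * (L * (2 * q))).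
  have scale (x y z u : K) : x * (y / z) * u = u * ((2 * z)^-1 * (y * (2 * x))).
    rewrite invfM; transitivity (u * (y * x / z) * (2^-1 * 2)); last by ring.
    by rewrite mulVf ?pnatr_eq0//; ring.
  by rewrite -exprVn scale.
rewrite [leRHS]sqrtrM ?sqr_ge0// sqrtr_sqr (@sqrtrM _ (2 * l)^-1); last first.
  by rewrite invr_ge0 mulr_ge0// ltW.
rewrite sqrtrV; last by rewrite mulr_ge0// ltW.
rewrite ler_pdivrMr// invfM -mulrA [leLHS]mulrCA.
apply: (@le_trans _ _ (`|e^-1| * ((Num.sqrt (2 * l))^-1 * m))).
  apply: ler_wpM2r; last exact: ler_norm.
  by apply: mulr_ge0 => //; rewrite invr_ge0 sqrtr_ge0.
rewrite -mulrA; apply: ler_wpM2l => //; rewrite -mulrA.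
by apply: ler_wpM2l; [rewrite invr_ge0 ltW|rewrite mulrC].
Qed.

End hilbert_bounds.

(** * Normal vectors and measurability of the effectivity *)

Section normal_vectors.
Context d (T : measurableType d) {K : realType} (P : probability T K).
Local Notation G := (measurableTypeR K).

Definition row_of_tuple n (x : n.-tuple K) : 'rV[K]_n := \row_j tnth x j.

Lemma iid_random_normal_vector n (X : {RV P >-> n.-tuple K}) :
  random_normal_vector X -> iid_normal P (fun w => row_of_tuple (X w)).
Proof.
move=> [indep law]; split.
  move=> j; rewrite (_ : (fun w => _) = entry X j).
    exact: measurable_entry.
  by apply/funext => w; rewrite /= mxE.
move=> A mA; have := indep [set: 'I_n]%SET A (fun i _ => mA i).
rewrite (_ : [set w | _] = [set w | forall j, A j (row_of_tuple (X w) ord0 j)]).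
  move=> ->; apply: eq_big => [j|j _]; first by rewrite inE.
  exact: (law j (A j) (mA j)).
apply/seteqP; split => w /= h j.
  by rewrite mxE; apply: h; rewrite inE.
by move=> _; have := h j; rewrite mxE.
Qed.

Lemma probability_bigsetU_le (I : Type) (s : seq I) (F : I -> set T) (p : K) :
  (forall i, measurable (F i)) -> (forall i, P (F i) = p%:E) ->
  (P (\big[setU/set0]_(i <- s) F i) <= ((size s)%:R * p)%:E)%E.
Proof.
move=> mF PF; elim: s => [|i s IH]; first by rewrite big_nil measure0 mul0r.
rewrite big_cons; apply: (@le_trans _ _ (P (F i) + P (\big[setU/set0]_(j <- s) F j))%E).
  by apply: measureU2 => //; exact: bigsetU_measurable.
rewrite PF /= -natr1 mulrDl mul1r addrC EFinD.
by apply: leeD.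
Qed.

End normal_vectors.

Section measurability.
Context d (T : measurableType d) {K : realType}.

Lemma measurable_quad n (M : 'M[K]_n) (X : T -> 'rV[K]_n) :
  (forall j, measurable_fun setT (fun w => X w ord0 j)) ->
  measurable_fun setT (fun w => quad M (X w)).
Proof.
move=> mX; rewrite (_ : (fun w => _) =
    fun w => \sum_j (\sum_i X w ord0 i * M i j) * X w ord0 j).
  apply: measurable_sum => j; apply: measurable_funM; last exact: mX.
  by apply: measurable_sum => i; apply: measurable_funM => //; exact: mX.
by apply/funext => w; exact: quadE.
Qed.

Lemma measurable_bigmax0 (I : Type) (s : seq I) (f : I -> T -> K) :
  (forall i, measurable_fun setT (f i)) ->
  measurable_fun setT (fun w => \big[Num.max/0]_(i <- s) f i w).
Proof.
move=> mf; elim: s => [|i s IH].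
  by rewrite (_ : (fun w => _) = cst 0)//; apply/funext => w; rewrite big_nil.
rewrite (_ : (fun w => _) = (f i \max (fun w => \big[Num.max/0]_(i <- s) f i w))).
  exact: measurable_maxr.
by apply/funext => w; rewrite big_cons.
Qed.

End measurability.

(** * The probabilistic bound on the effectivity *)

Theorem proposition3p8 (K : realType) (S R : vectType K)
    (ipS : {dot S for idfun}) (ipR : {dot R for idfun})
    (B : (\dim {:S}).-tuple S) (hB : basis_of fullv B)
    (O : 'Hom(S, R)) (hO : O != 0)
    (nt : nat) (hnt : (1 <= nt)%N)
    (eps : K) (heps : 0 < eps < 1)
    (d : measure_display) (T : measurableType d) (P : probability T K)
    (r : 'I_nt -> {RV P >-> (\dim {:S}).-tuple K})
    (hr : forall i, random_normal_vector (r i))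
    (hindep : mutually_independent r) :
  (P [set w | (effectivity ipS ipR B O eps (fun i => r i w) <=
               c_eff ipS B O nt eps)%R] >= (1 - eps)%:E)%E.
Proof.
set N := \dim {:S} in B hB r hr hindep *; set k := \dim (limg O).
have /andP[eps0 eps1] := heps.
have k0 : (0 < k)%N.
  rewrite lt0n dimv_eq0; apply: contra hO => /eqP O0; apply/eqP/lfunP => v.
  by apply/eqP; rewrite lfunE -memv0 -O0 memv_img ?memvf.
have kN : (k <= N)%N by have := limg_ker_dim O fullv; rewrite -/N -/k => <-; exact: leq_addl.
have N0 : (0 < N)%N := leq_trans k0 kN.
pose X i w := row_of_tuple (r i w).
have iidX i : iid_normal P (X i) by exact: iid_random_normal_vector.
pose e := vbasis (limg O).
pose A : 'M[K]_(N, k) := \matrix_(i, j) coord e j (O B`_i).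
have OvecE x : O (passmx.vecof B x) = \sum_j (x *m A) ord0 j *: e`_j.
  rewrite [LHS](coord_vbasis (memv_img _ (memvf _))); apply: eq_bigr => j _.
  congr (_ *: _); rewrite mxE /passmx.vecof !linear_sum.
  by apply: eq_bigr => i _; rewrite !linearZ/= mxE.
have [V [J [gV cJ VA]]] := gaussian_row_compression P A kN.
have uV := gaussian_isometry_unit gV.
pose Y i w := X i w *m V.
have iidY i : iid_normal P (Y i) by exact: gV.2.
pose mask (y : 'rV[K]_N) : 'rV[K]_N := \row_j (if j \in J then y ord0 j else 0).
have mask_mul y : mask y *m (invmx V *m A) = y *m (invmx V *m A).
  apply/rowP => l; rewrite mxE [RHS]mxE; apply: eq_bigr => j _.
  rewrite [mask y ord0 j]mxE; case: ifPn => // jJ.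
  by have /rowP/(_ l) := VA j jJ; rewrite [LHS]mxE [RHS]mxE => ->; rewrite !mulr0.
(* V^-1 A has zero rows outside J, so the coordinates outside J of the rotated
   vector Y do not influence its image. *)
have Omask i w : O (passmx.vecof B (X i w)) =
    O (passmx.vecof B (mask (Y i w) *m invmx V)).
  by rewrite !OvecE -[_ *m invmx V *m A]mulmxA mask_mul mulmxA /Y mulmxK.
have sqnorm_mask i w : sqnorm (mask (Y i w) *m invmx V) = 2 * half_sqnorm_on (Y i) J w.
  rewrite -gV.1 mulmxKV// /half_sqnorm_on mulr_sumr [RHS]big_mkcond/=.
  apply: eq_bigr => j _; rewrite mxE; case: ifP => _; last by rewrite expr0n.
  by rewrite mulrCA divff ?mulr1// pnatr_eq0.
have ntgt0 : 0 < nt%:R :> K by rewrite ltr0n.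
have heps' : 0 < eps / nt%:R < 1.
  rewrite divr_gt0//= ltr_pdivrMr// mul1r (lt_le_trans eps1)//.
  by rewrite ler1n.
pose q := Qgamma_inv (k%:R / 2) (eps / nt%:R).
have i0 : 'I_nt := Ordinal hnt.
have [q0 Qq] : 0 <= q /\ Qgamma (k%:R / 2) q = eps / nt%:R.
  case: (k) k0 cJ @q => // k' _ cJ q.
  have [nu nu_gamma _] := half_sqnorm_on_law (iidY i0) cJ.
  exact: (Qgamma_invK nu_gamma heps').
pose bad i := [set w | q < half_sqnorm_on (Y i) J w].
have mbad i : measurable (bad i).
  rewrite (_ : bad i = half_sqnorm_on (Y i) J @^-1` `]q, +oo[).
    rewrite -[X in measurable X]setTI.
    exact: (measurable_half_sqnorm_on (iidY i) J).
  by apply/seteqP; split => w; rewrite /bad /= in_itv/= andbT.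
have Pbad i : P (bad i) = (eps / nt%:R)%:E.
  by rewrite /bad half_sqnorm_on_tail// cJ// Qq.
pose event := [set w | effectivity ipS ipR B O eps (fun i => r i w) <=
  c_eff ipS B O nt eps].
have good : ~` (\big[setU/set0]_(i <- enum 'I_nt) bad i) `<=` event.
  move=> w nbad; apply: (effectivity_le hB N0 q0) => // i.
  apply: (@le_trans _ _ (hnorm ipR (O (passmx.vecof B (X i w))))); first by [].
  rewrite Omask; apply: (le_trans (hnorm_image_vecof_le ipS ipR hB O N0 _)).
  apply: ler_wpM2l; first exact: (opnorm_ge0 ipS ipR hB O N0).
  apply: ler_wsqrtr; apply: ler_wpM2l; first exact: (lambda_max_gram_ge0 ipS hB N0).
  rewrite sqnorm_mask ler_pM2l// leNgt; apply/negP => qS; apply: nbad.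
  by rewrite (bigD1_seq i) ?enum_uniq ?mem_enum//=; left.
have mevent : measurable event.
  have mnorm i : measurable_fun setT (fun w => hnorm ipR (O (Dinv B (r i w)))).
    rewrite (_ : (fun w => _) = Num.sqrt \o (fun w => quad (image_gram ipR B O) (X i w))).
      apply: measurableT_comp.
        by apply: continuous_measurable_fun; exact: sqrt_continuous.
      by apply: measurable_quad => j; exact: (iidX i).1.
    apply/funext => w /=; rewrite -dot_image_vecof; reflexivity.
  have meff : measurable_fun setT
      (fun w => effectivity ipS ipR B O eps (fun i => r i w)).
    apply: measurable_funM => //; apply: measurable_funM => //.
    exact: measurable_bigmax0.
  rewrite (_ : event = (fun w => effectivity ipS ipR B O eps (fun i => r i w)) @^-1`
      `]-oo, c_eff ipS B O nt eps]).
    by rewrite -[X in measurable X]setTI; exact: meff.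
  by apply/seteqP; split => w; rewrite /event /= in_itv.
have mU : measurable (\big[setU/set0]_(i <- enum 'I_nt) bad i).
  exact: bigsetU_measurable.
apply: (@le_trans _ _ (P (~` (\big[setU/set0]_(i <- enum 'I_nt) bad i)))); last first.
  by apply: le_measure; rewrite ?inE//; exact: measurableC.
rewrite probability_setC// EFinB; apply: leeB => //.
have := probability_bigsetU_le (enum 'I_nt) mbad Pbad.
by rewrite size_enum_ord mulrCA divff ?mulr1// gt_eqF.
Qed.
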